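(* Let $f:M\to B$ be the 4-dimensional principally polarized stable Lagrangian fibration constructed (as in the context, with $n=2$) from $\ell=1$ and the potential function $$\Psi(z_1,z_2)=\frac{(z_1+5\sqrt{-1})^3+(z_2+5\sqrt{-1})^3+3z_1^2z_2+3z_1z_2^2}{6}$$ over a sufficiently small polydisk $B=\{|z_1|<\epsilon,|z_2|<\epsilon\}$, whose discriminant set is $\{z_2=0\}$. Then the characteristic cycle on the singular fiber $M_{(z_1,0)}=f^{-1}(z_1,0)$ is of type $I_k$ with $k<\infty$ if and only if $z_1\in\mathbb{Q}(\sqrt{-1})$. So the singular fibers of finite characteristic cycle $I_k$ ($k<\infty$) and the singular fibers of infinite characteristic cycle $I_\infty$ are both dense over the discriminant set. Moreover, the characteristic cycle of $M_{(z_1,0)}$ is precisely of type $I_k$ ($k<\infty$) for $z_1=1/k$. So singular fibers with characteristic cycles of type $I_k$ with any sufficiently large $k$ appear in this family.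
   Context: Construction of $f$ ($n=2$, $\ell=1$). For $k\in\mathbb{Z}$ let $E_k=\mathbb{C}^2$ with coordinates $(x_k,y_k)$. Let $E$ be the surface obtained from $\bigcup_kE_k$ by identifying $(x_k,y_k)$, $x_k\ne0$, with $(x_{k+1},y_{k+1})$, $y_{k+1}\ne0$, iff $x_{k+1}=x_k^2y_k$ and $y_{k+1}=1/x_k$. On $E$, $z_2:=x_ky_k$ and $\omega_E:=dx_k\wedge dy_k$ are independent of $k$. Let $\tilde X=\mathbb{C}\times\mathbb{C}^\times\times E$ with coordinates $z_1,w_1$ on the first two factors and symplectic form $dz_1\wedge\frac{dw_1}{w_1}+\omega_E$, and let $\tilde M\subset\tilde X$ be the part over $B$ under $(z_1,z_2)$. Write $\tilde\theta_i^j=\partial^2\Psi/\partial z_i\partial z_j$ (whose imaginary part is positive definite near $0$). The group $\mathbb{Z}^2$ acts freely, properly discontinuously and symplectically on $\tilde M$ over $B$ by, for $\gamma=(j,m)$ and $F_i=j\tilde\theta_1^i+m\tilde\theta_2^i$, $$T_\gamma^*z_i=z_i,\quad T_\gamma^*w_1=e^{2\pi\sqrt{-1}F_1}w_1,\quad T_\gamma^*x_k=e^{-2\pi\sqrt{-1}F_2}x_{k-m},\quad T_\gamma^*y_k=e^{2\pi\sqrt{-1}F_2}y_{k-m}.$$ $M:=\tilde M/\mathbb{Z}^2$ with the induced symplectic form $\omega$, and $f:M\to B$ is induced by $(z_1,z_2)$. Characteristic cycles: each singular fiber $f^{-1}(b)$, $b\in\{z_2=0\}$, is reduced and its normalization is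 a union of $\mathbb{P}^1$-bundles over a complex torus of dimension $n-1=1$, whose fibers map to curves tangent to the Hamiltonian vector field $\iota_\omega(f^*dz_2)$ ($\iota_\omega:\Omega^1_M\to T(M)$ induced by $\omega$). A characteristic cycle is a maximal connected union of the images in $f^{-1}(b)$ of these $\mathbb{P}^1$-fibers. It is of type $I_m$ ($1\le m<\infty$) if it is a finite cycle of $m$ such curves (as in Kodaira's $I_m$), and of type $I_\infty=A_\infty$ if it is an infinite chain; all characteristic cycles of one fiber have the same type. *)

(* Defs.v *)
From HB Require Import structures.
From mathcomp Require Import all_boot all_order all_algebra.
From mathcomp Require Import all_classical all_reals all_analysis.
From mathcomp Require Import complex generic_quotient ring.
From Stdlib Require Import Relation_Operators.

Set Implicit Arguments.
Unset Strict Implicit.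
Unset Printing Implicit Defensive.

Import Order.TTheory GRing.Theory Num.Theory numFieldNormedType.Exports.
Local Open Scope classical_set_scope.
Local Open Scope quotient_scope.
Local Open Scope ring_scope.
Local Open Scope complex_scope.

(* Naming R[i] as a numClosedFieldType gives it the topology and the complex  *)
(* derivative that MathComp-Analysis attaches to numFieldTypes.               *)
Definition Cx (R : realType) : numClosedFieldType := R[i].

Section Complex.
Variable R : realType.
Local Notation C := (Cx R).

Definition imagC : C := 0 +i* 1.

Definition cexp (z : C) : C :=
  let: a +i* b := (z : R[i]) in (expR a * cos b) +i* (expR a * sin b).

Definition two_pi_i : C := 0 +i* (2 * trigo.pi).

Lemma cexp0 : cexp 0 = 1.
Proof. by rewrite /cexp /= expR0 cos0 sin0 mulr1 mulr0. Qed.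

Lemma cexpD (x y : C) : cexp (x + y) = cexp x * cexp y.
Proof.
case: x y => [a b] [c d]; rewrite /cexp /= expRD cosD sinD.
apply/eqP; rewrite eq_complex /=; apply/andP; split; apply/eqP; ring.
Qed.

Lemma cexp_neq0 (x : C) : cexp x != 0.
Proof.
apply/eqP => h; have := cexpD x (- x).
by rewrite subrr cexp0 h mul0r => /eqP; rewrite oner_eq0.
Qed.

Definition gaussian_rational (z : C) : Prop :=
  exists p q : rat, z = ratr p + ratr q * imagC.

End Complex.

Section SurfaceE.
Variable R : realType.
Local Notation C := (Cx R).

(* (k, (x, y)) is the point (x_k, y_k) = (x, y) of E_k.                       *)
Definition Epre : choiceType := (int * (C * C))%type.

Inductive glue : Epre -> Epre -> Prop :=
  Glue (k : int) (x y : C) of x != 0 :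
    glue (k, (x, y)) (k + 1, (x ^+ 2 * y, x^-1)).

Definition glued (p q : Epre) : bool := `[< clos_refl_sym_trans _ glue p q >].

Lemma glued_refl : reflexive glued.
Proof. by move=> p; apply/asboolP; exact: rst_refl. Qed.

Lemma glued_sym : symmetric glued.
Proof.
by move=> p q; apply/idP/idP => /asboolP h; apply/asboolP; exact: rst_sym.
Qed.

Lemma glued_trans : transitive glued.
Proof.
move=> q p r /asboolP h1 /asboolP h2; apply/asboolP; exact: rst_trans h1 h2.
Qed.

Canonical glued_equiv := EquivRel glued glued_refl glued_sym glued_trans.

Definition E : Type := {eq_quot glued_equiv}.
HB.instance Definition _ := Choice.on E.
HB.instance Definition _ := EqQuotient.on E.

Lemma pi_E_eq p q : (\pi_E p = \pi_E q) <-> clos_refl_sym_trans _ glue p q.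
Proof.
split=> [/eqP|h]; first by rewrite [_ == _]piE => /asboolP.
by apply/eqP; rewrite [_ == _]piE; apply/asboolP.
Qed.

Definition Ept (k : int) (x y : C) : E := \pi_E (k, (x, y)).

Definition z2E (e : E) : C := (repr e).2.1 * (repr e).2.2.

Lemma glued_inv (T : Type) (h : Epre -> T) :
  (forall p q, glue p q -> h p = h q) -> forall p, h (repr (\pi_E p)) = h p.
Proof.
move=> hg p.
have H q r : clos_refl_sym_trans _ glue q r -> h q = h r.
  by elim=> [? ? /hg //|//|? ? _ ->//|? ? ? _ -> _ ->].
by apply/H/pi_E_eq; rewrite reprK.
Qed.

Lemma z2E_pt k x y : z2E (Ept k x y) = x * y.
Proof.
rewrite /z2E /Ept.
apply: (glued_inv (h := fun p : Epre => p.2.1 * p.2.2)) => _ _ [j a b a0] /=.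
by rewrite expr2 -!mulrA mulrCA [b / a]mulrC mulrA mulrA -[a * a * _]mulrA divff // mulr1.
Qed.

(* The map carrying the point (x, y) of E_k to (a^-1 x, a y) of E_(k+m).      *)
Definition actE (m : int) (a : C) (e : E) : E :=
  let p := repr e in Ept (p.1 + m) (a^-1 * p.2.1) (a * p.2.2).

Lemma actE_pt m a k x y : a != 0 ->
  actE m a (Ept k x y) = Ept (k + m) (a^-1 * x) (a * y).
Proof.
move=> a0; rewrite /actE.
pose h (p : Epre) := Ept (p.1 + m) (a^-1 * p.2.1) (a * p.2.2).
rewrite [LHS](glued_inv (h := h)) // => _ _ [j b c b0]; rewrite /h /=.
apply/pi_E_eq.
have -> : (j + 1 + m, (a^-1 * (b ^+ 2 * c), a * b^-1)) =
  (j + m + 1, ((a^-1 * b) ^+ 2 * (a * c), (a^-1 * b)^-1)) :> Epre.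
  congr (_, (_, _)); first by rewrite addrAC.
    by field.
  by rewrite invfM invrK.
by apply: rst_step; constructor; rewrite mulf_neq0 ?invr_neq0.
Qed.

Lemma E_ind (P : E -> Prop) : (forall k x y, P (Ept k x y)) -> forall e, P e.
Proof.
by move=> hP e; rewrite -[e]reprK; case: (repr e) => k [x y]; exact: hP.
Qed.

Lemma z2E_act m a e : a != 0 -> z2E (actE m a e) = z2E e.
Proof.
move=> a0; elim/E_ind: e => k x y; rewrite actE_pt // !z2E_pt.
by rewrite mulrACA mulVf // mul1r.
Qed.

Lemma actE0 e : actE 0 1 e = e.
Proof.
by elim/E_ind: e => k x y; rewrite actE_pt ?oner_eq0 // addr0 invr1 !mul1r.
Qed.

Lemma actED m m' a a' e : a != 0 -> a' != 0 ->
  actE m a (actE m' a' e) = actE (m + m') (a * a') e.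
Proof.
move=> a0 a0'; elim/E_ind: e => k x y; rewrite !actE_pt ?mulf_neq0 //.
by rewrite -addrA [m' + m]addrC !mulrA invfM.
Qed.

End SurfaceE.

Arguments Ept {R}.

Section Fibration.
Variables (R : realType) (Psi : Cx R * Cx R -> Cx R) (eps : R).
Local Notation C := (Cx R).
Local Notation E := (E R).

Definition in_polydisk (z : C * C) : bool :=
  (`|z.1| < eps%:C) && (`|z.2| < eps%:C).

Definition polydisk : set (C * C) := [set z | in_polydisk z].

Definition pderiv1 (g : C * C -> C) (z : C * C) : C :=
  'D_1 (fun t : C => g (t, z.2)) z.1.
Definition pderiv2 (g : C * C -> C) (z : C * C) : C :=
  'D_1 (fun t : C => g (z.1, t)) z.2.

Definition F1 (g : int * int) (z : C * C) : C :=
  g.1%:~R * pderiv1 (pderiv1 Psi) z + g.2%:~R * pderiv2 (pderiv1 Psi) z.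
Definition F2 (g : int * int) (z : C * C) : C :=
  g.1%:~R * pderiv1 (pderiv2 Psi) z + g.2%:~R * pderiv2 (pderiv2 Psi) z.

(* Points of C x C x E are written (z1, w1, e).                               *)
Definition base (p : C * C * E) : C * C := (p.1.1, z2E p.2).

Definition in_tM (p : C * C * E) : bool :=
  (p.1.2 != 0) && in_polydisk (base p).

Definition tM : choiceType := {p : C * C * E | in_tM p}.

(* T_g^* x_k = e^{-2 pi i F_2} x_(k-m), so T_g sends E_(k-m) to E_k.          *)
Definition act_raw (g : int * int) (p : C * C * E) : C * C * E :=
  (p.1.1, cexp (two_pi_i R * F1 g (base p)) * p.1.2,
   actE g.2 (cexp (two_pi_i R * F2 g (base p))) p.2).

Lemma base_act g p : base (act_raw g p) = base p.
Proof. by rewrite /base /act_raw /= z2E_act // cexp_neq0. Qed.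

Lemma act_in g p : in_tM p -> in_tM (act_raw g p).
Proof.
rewrite /in_tM base_act => /andP[w0 ->]; rewrite andbT /=.
by rewrite mulf_neq0 // cexp_neq0.
Qed.

Definition act (g : int * int) (p : tM) : tM :=
  exist _ (act_raw g (val p)) (act_in g (valP p)).

Lemma act0 p : act (0, 0) p = p.
Proof.
apply: val_inj => /=; case: (val p) => -[z w] e; rewrite /act_raw.
have -> b : F1 (0, 0) b = 0.
  rewrite /F1; move: (pderiv1 _ b) (pderiv2 _ b) => x y.
  by rewrite /= mulr0z !mul0r addr0.
have -> b : F2 (0, 0) b = 0.
  rewrite /F2; move: (pderiv1 _ b) (pderiv2 _ b) => x y.
  by rewrite /= mulr0z !mul0r addr0.
by rewrite mulr0 cexp0 /= mul1r actE0.
Qed.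

Lemma actD g h p : act g (act h p) = act (g.1 + h.1, g.2 + h.2) p.
Proof.
apply: val_inj => /=; rewrite {1}/act_raw base_act /act_raw /=.
have <- : F1 g (base (val p)) + F1 h (base (val p)) =
    F1 (g.1 + h.1, g.2 + h.2) (base (val p)).
  rewrite /F1; move: (pderiv1 _ _) (pderiv2 _ _) => x y.
  by rewrite /= !intrD !mulrDl addrACA.
have <- : F2 g (base (val p)) + F2 h (base (val p)) =
    F2 (g.1 + h.1, g.2 + h.2) (base (val p)).
  rewrite /F2; move: (pderiv1 _ _) (pderiv2 _ _) => x y.
  by rewrite /= !intrD !mulrDl addrACA.
move: (F1 g _) (F1 h _) (F2 g _) (F2 h _) => a b c d.
by rewrite !mulrDr !cexpD actED ?cexp_neq0 // mulrA.
Qed.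

Definition same_orbit (p q : tM) : bool := `[< exists g, q = act g p >].

Lemma same_orbit_refl : reflexive same_orbit.
Proof. by move=> p; apply/asboolP; exists (0, 0); rewrite act0. Qed.

Lemma same_orbit_sym : symmetric same_orbit.
Proof.
suff h p q : same_orbit p q -> same_orbit q p by move=> p q; apply/idP/idP => /h.
move=> /asboolP[g ->]; apply/asboolP; exists (- g.1, - g.2).
by rewrite actD /= !addNr act0.
Qed.

Lemma same_orbit_trans : transitive same_orbit.
Proof.
move=> q p r /asboolP[g ->] /asboolP[h ->]; apply/asboolP.
by exists (h.1 + g.1, h.2 + g.2); rewrite actD.
Qed.

Canonical same_orbit_equiv :=
  EquivRel same_orbit same_orbit_refl same_orbit_sym same_orbit_trans.

Definition M : Type := {eq_quot same_orbit_equiv}.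
HB.instance Definition _ := Choice.on M.
HB.instance Definition _ := EqQuotient.on M.

Lemma pi_M_eq p q : (\pi_M p = \pi_M q) <-> exists g, q = act g p.
Proof.
split=> [/eqP|h]; first by rewrite [_ == _]piE => /asboolP.
by apply/eqP; rewrite [_ == _]piE; apply/asboolP.
Qed.

Definition fibr (m : M) : C * C := base (val (repr m)).

Lemma fibr_pi (p : tM) : fibr (\pi_M p) = base (val p).
Proof.
rewrite /fibr.
have /pi_M_eq[g ->] : \pi_M p = \pi_M (repr (\pi_M p)) by rewrite reprK.
by rewrite /= base_act.
Qed.

(* Since the covering map from tM to M is a local biholomorphism, the         *)
(* coordinates v = (z1, w1, x_k, y_k) serve as local coordinates on M too.    *)
Definition crd (v : 'rV[C]_4) (n : nat) : C := v 0 (inord n).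

Definition has_coords (k : int) (v : 'rV[C]_4) (m : M) : Prop :=
  exists2 p : tM, val p = (crd v 0, crd v 1, Ept k (crd v 2) (crd v 3)) &
                  m = \pi_M p.

(* The symplectic form dz1 /\ dw1/w1 + dx_k /\ dy_k at the point v, and the   *)
(* differentials of z1 and z2 = x_k y_k.                                      *)
Definition omega (v a b : 'rV[C]_4) : C :=
  (crd a 0 * crd b 1 - crd a 1 * crd b 0) / crd v 1
  + (crd a 2 * crd b 3 - crd a 3 * crd b 2).

Definition dz1 (v a : 'rV[C]_4) : C := crd a 0.
Definition dz2 (v a : 'rV[C]_4) : C := crd v 3 * crd a 2 + crd v 2 * crd a 3.

Definition hamiltonian_z2 (v h : 'rV[C]_4) : Prop :=
  forall a, omega v h a = dz2 v a.

Definition critical (m : M) : Prop :=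
  exists k v, has_coords k v m /\
    exists c : C * C, c != (0, 0) /\
      forall a, c.1 * dz1 v a + c.2 * dz2 v a = 0.

Definition discriminant : set (C * C) := fibr @` critical.

Definition velocity (phi : C -> 'rV[C]_4) (s : C) : 'rV[C]_4 :=
  \row_i 'D_1 (fun t : C => phi t 0 i) s.

Definition lifts_near (g : C -> M) (s0 : C) (k : int) (phi : C -> 'rV[C]_4) :=
  \forall s \near s0, has_coords k (phi s) (g s) /\
    forall i, derivable (fun t : C => phi t 0 i) s 1.

(* None is the point at infinity of P^1; the two affine coordinates are s and *)
(* t = 1/s.                                                                   *)
Definition P1 : Type := option C.
Definition P1_zero (s : C) : P1 := Some s.
Definition P1_infty (t : C) : P1 := if t == 0 then None else Some t^-1.

(* g, defined near s0, is holomorphic there, and away from the critical       *)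
(* points of fibr it is an immersion tangent to the Hamiltonian vector field  *)
(* of z2.                                                                     *)
Definition hol_tangent_at (g : C -> M) (s0 : C) : Prop :=
  exists k phi, lifts_near g s0 k phi /\
    \forall s \near s0, ~ critical (g s) ->
      exists2 c : C, c != 0 & hamiltonian_z2 (phi s) (c *: velocity phi s).

(* u is the restriction to a P^1-fibre of the normalization nu of the reduced *)
(* singular fibre over b.  As nu is finite, and an isomorphism over the       *)
(* smooth locus (the complement of the critical points of fibr), u is an      *)
(* injective immersion there and meets its complement in finitely many        *)
(* points.                                                                    *)
Definition P1_fiber_map (b : C * C) (u : P1 -> M) : Prop :=
  [/\ forall s, fibr (u s) = b,
      (forall s, hol_tangent_at (u \o P1_zero) s) /\
      (forall t, hol_tangent_at (u \o P1_infty) t),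
      finite_set [set s | critical (u s)] &
      forall s t, ~ critical (u s) -> u s = u t -> s = t].

Definition characteristic_curve (b : C * C) : set (set M) :=
  [set range u | u in P1_fiber_map b].

(* Connectedness of a family of curves is through chains of consecutively     *)
(* meeting members: topologically, the union of all the (uncountably many)    *)
(* curves of one fibre is the whole fibre.                                    *)
Definition connected_family (F : set (set M)) : Prop :=
  forall A B, F A -> F B ->
    clos_refl_trans _ (fun X Y => [/\ F X, F Y & X `&` Y !=set0]) A B.

Definition curve_family (b : C * C) (F : set (set M)) : Prop :=
  [/\ F !=set0, F `<=` characteristic_curve b & connected_family F].

Definition characteristic_cycle (b : C * C) (Theta : set M) : Prop :=
  exists F, [/\ curve_family b F,
    (forall G, curve_family b G -> F `<=` G -> G = F) &
    Theta = \bigcup_(A in F) A].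

Definition transversal (g h : C -> M) : Prop :=
  exists k phi psi, [/\ lifts_near g 0 k phi, lifts_near h 0 k psi,
    phi 0 = psi 0 & row_free (col_mx (velocity phi 0) (velocity psi 0))].

(* Theta is a chain of curves u_i, with i in Z/m (in Z when m = 0), where     *)
(* u_i(infty) = u_(i+1)(0) is a transversal crossing and no other points are  *)
(* identified.  For m = 1 this is one nodal rational curve; for m = 2, two    *)
(* curves crossing at two points.                                             *)
Definition chain_mod (m : nat) (b : C * C) (Theta : set M) : Prop :=
  exists u : int -> P1 -> M,
    [/\ forall i, P1_fiber_map b (u i),
        forall i j s t, u i s = u j t <->
          [\/ (i = j %[mod m])%Z /\ s = t,
              [/\ (j = i + 1 %[mod m])%Z, s = None & t = Some 0] |
              [/\ (i = j + 1 %[mod m])%Z, s = Some 0 & t = None]],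
        forall i, transversal (u i \o P1_infty) (u (i + 1) \o P1_zero) &
        Theta = \bigcup_i range (u i)].

Definition type_I (m : nat) (b : C * C) (Theta : set M) : Prop :=
  (0 < m)%N /\ chain_mod m b Theta.

Definition type_I_infty (b : C * C) (Theta : set M) : Prop :=
  chain_mod 0 b Theta.

Definition has_cycle_type (b : C * C) (P : C * C -> set M -> Prop) : Prop :=
  (exists Theta, characteristic_cycle b Theta) /\
  forall Theta, characteristic_cycle b Theta -> P b Theta.

Definition cycle_I (k : nat) (b : C * C) : Prop := has_cycle_type b (type_I k).

Definition cycle_I_infty (b : C * C) : Prop := has_cycle_type b type_I_infty.

End Fibration.

Arguments polydisk {R} eps.
Arguments discriminant {R} Psi eps.
Arguments cycle_I {R} Psi eps k b.
Arguments cycle_I_infty {R} Psi eps b.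

Definition Psi0 (R : realType) (z : Cx R * Cx R) : Cx R :=
  let: (z1, z2) := z in
  ((z1 + 5 * imagC R) ^+ 3 + (z2 + 5 * imagC R) ^+ 3
   + 3 * z1 ^+ 2 * z2 + 3 * z1 * z2 ^+ 2) / 6.

Arguments Psi0 R z : clear implicits.

(* Main.v *)
(* Over z2 = 0 the surface E is an infinite chain of lines C_n, and the fibre  *)
(* of the covering space over (z1, 0) is C^* x (chain).  An element (j, m) of  *)
(* Z^2 maps {w} x C_n to {q w} x C_(n + m) with q = exp(2 pi i F_1),           *)
(* F_1 = (j + m) z1 + 5 i j.  As |Im z1| < 5, q = 1 and m = 0 force j = 0, so  *)
(* the stabiliser of {w} x (chain) acts on the chain through a group of shifts *)
(* k Z, and the image of the chain is of type I_k, or I_infty when k = 0.      *)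
(* Solving F_1 in Z gives k > 0 iff z1 is in Q(i), and exactly k for z1 = 1/k. *)
(*                                                                             *)
(* It remains to see that the characteristic curves are exactly the images of  *)
(* the {w} x C_n.  Along a P^1-fibre map u, tangency to the Hamiltonian field  *)
(* x d/dx - y d/dy makes w locally constant, so off finitely many points u     *)
(* lies on one line and has a coordinate x <> 0 there with nonzero derivative, *)
(* tending to 0 or infinity at the exceptional points.  Such an x takes every  *)
(* value: if |x(p) - v| < |v| for some p, then min(|x - v|, |v|) attains its   *)
(* minimum on P^1 at a point where |x - v| has a local minimum, which forces   *)
(* x = v because dx <> 0; and the discs |v - x| < |v| connect C^*.             *)

Require Import Defs.
From mathcomp Require Import all_boot all_order all_algebra.
From mathcomp Require Import all_classical all_reals all_analysis.
From mathcomp Require Import complex generic_quotient ring lra.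
From Stdlib Require Import Relation_Operators.

Set Implicit Arguments.
Unset Strict Implicit.
Unset Printing Implicit Defensive.

Import Order.TTheory GRing.Theory Num.Theory numFieldNormedType.Exports.
Local Open Scope classical_set_scope.
Local Open Scope quotient_scope.
Local Open Scope ring_scope.
Local Open Scope complex_scope.

(** * The complex line as a real normed plane *)

(** Over (z1, 0) the answer is governed by one subgroup of Z, [stab]: the shifts m for which some
    (j, m) has exp(2 pi i F_1) = 1. A characteristic cycle is the image of {w} x (chain of lines),
    and two points of that set are identified exactly by group elements fixing w, so the cycle is
    the chain modulo the shifts in [stab]. By [stab_generator] these are the multiples of some k;
    [lines_chain_mod] exhibits the quotient as a cycle of k lines, or as an infinite chain when k =
    0, and [chain_mod_stab] shows conversely that a finite cycle forces a nonzero shift.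

    The arithmetic is elementary: F_1 = (j + m) z1 + 5 i j equals an integer N iff (j + m) Re z1 = N
    and (j + m) Im z1 = - 5 j. This has a solution with m nonzero iff z1 is a Gaussian rational
    ([gaussian_stab]), and for z1 = 1/k it forces j = 0 and k | m ([stab_inv_nat]). Density comes
    from the density of Q(i) and of its complement.

    The geometric half is [characteristic_curveP]. Characteristic curves are ranges of arbitrary
    P^1-fibre maps u, so each such range must be shown to be a full line. Tangency makes w locally
    constant ([local_lift]), and connectedness of a cofinite set confines u to one line off its
    critical points ([noncritical_single_line]). A minimum argument on the sphere ([P1_min],
    [derivable_not_local_min]) then shows that the coordinate of u takes every nonzero value
    ([lcoord_onto]) and that both nodes are reached ([node0_hit], [nodeoo_hit]). *)

Section Modulus.
Variable R : realType.
Local Notation C := (Cx R).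
Implicit Types (z w : C) (s t : C).

Definition rpart z : R := complex.Re z.
Definition ipart z : R := complex.Im z.
Definition ofR (a : R) : C := a%:C.
(** The norm of [R[i]] takes values in [R[i]]; a real-valued modulus is needed for minima,
    compactness and the mean value theorem. *)
Definition cmod z : R := complex.Re (`|z| : C).

Lemma normE z : `|z| = ofR (cmod z) :> C.
Proof. by rewrite /cmod /ofR normc_def. Qed.

Lemma ofR_inj : injective ofR. Proof. by move=> a b []. Qed.

Lemma ofRD a b : ofR (a + b) = ofR a + ofR b. Proof. exact: (rmorphD (real_complex R)). Qed.
Lemma ofRB a b : ofR (a - b) = ofR a - ofR b. Proof. exact: (rmorphB (real_complex R)). Qed.
Lemma ofRM a b : ofR (a * b) = ofR a * ofR b. Proof. exact: (rmorphM (real_complex R)). Qed.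
Lemma ofRV a : ofR a^-1 = (ofR a)^-1. Proof. exact: (fmorphV (real_complex R)). Qed.
Lemma ofR0 : ofR 0 = 0. Proof. by []. Qed.
Lemma ofR1 : ofR 1 = 1. Proof. by []. Qed.
Lemma ofR_nat n : ofR n%:R = n%:R. Proof. exact: (rmorph_nat (real_complex R)). Qed.
Lemma ofR_int n : ofR n%:~R = n%:~R. Proof. exact: (rmorph_int (real_complex R)). Qed.
Lemma ofR_eq0 a : (ofR a == 0) = (a == 0). Proof. exact: (fmorph_eq0 (real_complex R)). Qed.
Lemma ler_ofR a b : (ofR a <= ofR b) = (a <= b). Proof. exact: lecR. Qed.
Lemma ltr_ofR a b : (ofR a < ofR b) = (a < b). Proof. exact: ltcR. Qed.

Lemma cmod_ge0 z : 0 <= cmod z. Proof. by rewrite -ler_ofR -normE normr_ge0. Qed.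
Lemma cmod0 : cmod 0 = 0. Proof. by rewrite /cmod normr0. Qed.
Lemma cmod_eq0 z : (cmod z == 0) = (z == 0).
Proof. by rewrite -ofR_eq0 -normE normr_eq0. Qed.
Lemma cmod_gt0 z : (0 < cmod z) = (z != 0).
Proof. by rewrite lt_neqAle cmod_ge0 andbT eq_sym cmod_eq0. Qed.
Lemma cmodM z w : cmod (z * w) = cmod z * cmod w.
Proof. by apply: ofR_inj; rewrite ofRM -!normE normrM. Qed.
Lemma cmodV z : cmod z^-1 = (cmod z)^-1.
Proof. by apply: ofR_inj; rewrite ofRV -!normE normfV. Qed.
Lemma cmodN z : cmod (- z) = cmod z. Proof. by rewrite /cmod normrN. Qed.
Lemma cmodB z w : cmod (z - w) = cmod (w - z). Proof. by rewrite -cmodN opprB. Qed.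
Lemma cmodD z w : cmod (z + w) <= cmod z + cmod w.
Proof. by rewrite -ler_ofR ofRD -!normE ler_normD. Qed.
Lemma cmod_ofR a : cmod (ofR a) = `|a|.
Proof. by rewrite /cmod normc_def /= expr0n addr0 sqrtr_sqr. Qed.
Lemma cmod_sub z w : cmod z - cmod w <= cmod (z - w).
Proof. by rewrite lerBlDr -{1}[z](subrK w); exact: cmodD. Qed.
Lemma cmodE z : cmod z = Num.sqrt (rpart z ^+ 2 + ipart z ^+ 2).
Proof. by rewrite /cmod normc_def. Qed.
Lemma cmod_sqr z : cmod z ^+ 2 = rpart z ^+ 2 + ipart z ^+ 2.
Proof. by rewrite cmodE sqr_sqrtr // addr_ge0 ?sqr_ge0. Qed.
Lemma rpart_le z : `|rpart z| <= cmod z.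
Proof. by rewrite cmodE -sqrtr_sqr ler_wsqrtr // lerDl sqr_ge0. Qed.
Lemma ipart_le z : `|ipart z| <= cmod z.
Proof. by rewrite cmodE -sqrtr_sqr ler_wsqrtr // lerDr sqr_ge0. Qed.
Lemma cmod_le z : cmod z <= `|rpart z| + `|ipart z|.
Proof.
have h := normr_ge0 (rpart z); have h' := normr_ge0 (ipart z).
rewrite -(ler_pXn2r (n := 2)) ?nnegrE ?addr_ge0 ?cmod_ge0 //.
rewrite cmod_sqr sqrrD !real_normK ?num_real // -addrA lerD2l lerDr.
by rewrite mulrn_wge0 // mulr_ge0.
Qed.

Lemma rpartD z w : rpart (z + w) = rpart z + rpart w.
Proof. by case: z w => a b []. Qed.
Lemma ipartD z w : ipart (z + w) = ipart z + ipart w.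
Proof. by case: z w => a b []. Qed.
Lemma rpartN z : rpart (- z) = - rpart z. Proof. by case: z. Qed.
Lemma ipartN z : ipart (- z) = - ipart z. Proof. by case: z. Qed.
Lemma rpart_ofRM a z : rpart (ofR a * z) = a * rpart z.
Proof. by case: z => x y /=; rewrite /rpart /= mul0r subr0. Qed.
Lemma ipart_ofRM a z : ipart (ofR a * z) = a * ipart z.
Proof. by case: z => x y /=; rewrite /ipart /= mul0r addr0. Qed.
Lemma rpart_i z : rpart (imagC R * z) = - ipart z.
Proof. by case: z => x y; rewrite /rpart /ipart /= mul0r mul1r add0r. Qed.
Lemma C_eq z w : rpart z = rpart w -> ipart z = ipart w -> z = w.
Proof. by case: z w => a b [c d]; rewrite /rpart /ipart /= => -> ->. Qed.

Lemma nearCP (s : C) (P : C -> Prop) :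
  (\forall t \near s, P t) <->
  exists2 d : R, 0 < d & forall t, cmod (t - s) < d -> P t.
Proof.
split.
  move=> /nbhs_ballP[e /= e0 he].
  (* A radius is an element of [R[i]]; being positive, it is real. *)
  have eR : e = ofR (rpart e).
    by move: (e0); rewrite lt0r => /andP[_ /ger0_real/RRe_real].
  exists (rpart e); first by rewrite -ltr_ofR -eR.
  by move=> t ht; apply: he; rewrite /ball /= normE eR ltr_ofR cmodB.
case=> d d0 hd; apply/nbhs_ballP; exists (ofR d); first by rewrite /= ltr_ofR.
by move=> t; rewrite /ball /= normE ltr_ofR cmodB => /hd.
Qed.

Lemma nearCW (s : C) (P : C -> Prop) : (forall t, P t) -> \forall t \near s, P t.
Proof. by move=> H; apply/nearCP; exists 1. Qed.

Lemma near0CP (P : C -> Prop) :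
  (\forall h \near (0 : C)^', P h) <->
  exists2 d : R, 0 < d & forall h, h != 0 -> cmod h < d -> P h.
Proof.
rewrite /dnbhs /within /=; split.
  move=> /nearCP[d d0 hd]; exists d => // h h0 hm.
  by apply: hd => //; rewrite subr0.
move=> [d d0 hd]; apply/nearCP; exists d => // h; rewrite subr0 => ? ?; exact: hd.
Qed.

Lemma derivable_approx (f : C -> C) s : derivable f s 1 ->
  forall e, 0 < e -> exists2 d, 0 < d & forall h, cmod h < d ->
    cmod (f (s + h) - f s - 'D_1 f s * h) <= e * cmod h.
Proof.
move=> df e e0.
have /cvg_ballP/(_ (ofR e)) : (fun h => h^-1 *: (f (h *: (1 : C) + s) - f s)) @ 0^' --> 'D_1 f s.
  exact: df.
rewrite ltr_ofR => /(_ e0)/near0CP[d d0 hd]; exists d => // h hm.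
have [->|h0] := eqVneq h 0.
  by rewrite addr0 subrr mulr0 subrr cmod0 mulr0.
have := hd _ h0 hm; rewrite /ball /= normE ltr_ofR => /ltW.
rewrite -(ler_pM2r (x := cmod h)) ?cmod_gt0 // -cmodM => H.
apply: le_trans H; rewrite cmodB le_eqVlt; apply/orP; left; apply/eqP; congr cmod.
have -> : h *: (1 : C) = h by exact: mulr1.
rewrite /GRing.scale /= [h + s]addrC; set a := f _ - f s.
by rewrite mulrBl mulrAC mulVf // mul1r.
Qed.

Lemma approx_cont (f : C -> C) s d0 : 
  (forall e, 0 < e -> exists2 d, 0 < d & forall h, cmod h < d ->
    cmod (f (s + h) - f s - d0 * h) <= e * cmod h) ->
  forall e, 0 < e -> exists2 d, 0 < d & forall t, cmod (t - s) < d ->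
    cmod (f t - f s) < e.
Proof.
move=> /(_ 1 ltr01)[d dp hd] e e_gt0.
have K0 : 0 < 1 + cmod d0 by rewrite ltr_pwDl // cmod_ge0.
exists (Num.min d (e / (1 + cmod d0))); first by rewrite lt_min dp divr_gt0.
move=> t; rewrite lt_min => /andP[/hd]; rewrite subrKC mul1r => H1.
rewrite ltr_pdivlMr // => H2; apply: le_lt_trans H2.
rewrite mulrDr mulr1 [cmod (t - s) * _]mulrC -cmodM.
rewrite -[f t - f s](subrK (d0 * (t - s))).
by apply: le_trans (cmodD _ _) _; rewrite lerD2r.
Qed.

Lemma derivable_cont (f : C -> C) s : derivable f s 1 ->
  forall e, 0 < e -> \forall t \near s, cmod (f t - f s) < e.
Proof.
move=> /derivable_approx/approx_cont H e /H[d d0 hd]; by apply/nearCP; exists d.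
Qed.

End Modulus.

(** * Constancy along segments and off finite sets *)

Section Constancy.
Variable R : realType.
Local Notation C := (Cx R).
Implicit Types (z w s t : C).

(** Vanishing derivative written as an inequality, so that it applies equally to holomorphic
    functions and to indicator functions. *)
Definition flat_at (f : C -> C) s := forall e, 0 < e ->
  exists2 d, 0 < d & forall h, cmod h < d -> cmod (f (s + h) - f s) <= e * cmod h.

Definition cont_at (f : C -> C) s := forall e, 0 < e ->
  exists2 d, 0 < d & forall t, cmod (t - s) < d -> cmod (f t - f s) < e.

Lemma derivable_flat (f : C -> C) s : derivable f s 1 -> 'D_1 f s = 0 -> flat_at f s.
Proof.
move=> /derivable_approx H D0 e /H[d d0 hd]; exists d => // h /hd.
by rewrite D0 mul0r subr0.
Qed.

Lemma derivable_cont_at (f : C -> C) s : derivable f s 1 -> cont_at f s.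
Proof. by move=> /derivable_approx/approx_cont. Qed.

Lemma flat_cont (f : C -> C) s : flat_at f s -> cont_at f s.
Proof.
move=> H; apply: (@approx_cont _ f s 0) => e /H[d d0 hd].
by exists d => // h /hd; rewrite mul0r subr0.
Qed.

Definition seg z w (r : R) : C := z + ofR r * (w - z).

(** The mean value theorem for r |-> L (f (seg z w r)) on [0, 1], whose derivative is 0; [L] will be
    the real or the imaginary part. The endpoints need continuity only. *)
Lemma seg_constant_part (L : C -> R) (f : C -> C) z w :
  (forall a b, L a - L b = L (a - b)) -> (forall a, `|L a| <= cmod a) ->
  (forall r, 0 <= r <= 1 -> cont_at f (seg z w r)) ->
  (forall r, 0 < r < 1 -> flat_at f (seg z w r)) -> L (f z) = L (f w).
Proof.
move=> LB Lle fc ff; pose G (r : R) := L (f (seg z w r)).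
have K0 : 0 < 1 + cmod (w - z) by rewrite ltr_pwDl // cmod_ge0.
have segB r r' : seg z w r' - seg z w r = ofR (r' - r) * (w - z).
  by rewrite /seg ofRB; ring.
have Gc r : 0 <= r <= 1 -> {for r, continuous G}.
  move=> /fc H; apply/(@cvgrPdist_lt _ R^o) => e /H[d d0 hd].
  apply/nbhs_ballP; exists (d / (1 + cmod (w - z))); first by rewrite /= divr_gt0.
  move=> t; rewrite /ball /= distrC ltr_pdivlMr // => ht.
  rewrite /G distrC LB; apply: le_lt_trans (Lle _) _; apply: hd.
  rewrite segB cmodM cmod_ofR; apply: le_lt_trans ht.
  by rewrite ler_wpM2l // lerDr.
have Gd (r : R) : r \in `]0, 1[ -> is_derive r (1 : R) G 0.
  rewrite in_itv /= => /ff H.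
  suff : (fun h => h^-1 *: (G (h *: (1 : R) + r) - G r)) @ 0^' --> (0 : R^o).
    move=> h; apply: DeriveDef; last exact: cvg_lim h.
    by apply/cvg_ex; exists 0.
  apply/(@cvgrPdist_le _ R^o) => e e0.
  have [|d d0 hd] := H (e / (1 + cmod (w - z))); first by rewrite divr_gt0.
  apply/nbhs_ballP; exists (d / (1 + cmod (w - z))); first by rewrite /= divr_gt0.
  move=> t; rewrite /ball /= sub0r normrN ltr_pdivlMr // => ht t0.
  rewrite sub0r normrN.
  have -> : t *: (1 : R) + r = r + t by rewrite [t *: _]mulr1 addrC.
  rewrite /GRing.scale /= normrM normfV ler_pdivrMl ?normr_gt0 //.
  rewrite /G LB; apply: le_trans (Lle _) _.
  have E : seg z w (r + t) = seg z w r + ofR t * (w - z) by rewrite /seg ofRD; ring.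
  have le1 : cmod (ofR t * (w - z)) <= `|t| * (1 + cmod (w - z)).
    by rewrite cmodM cmod_ofR ler_wpM2l // lerDr.
  rewrite E; apply: le_trans (hd _ (le_lt_trans le1 ht)) _.
  rewrite mulrAC ler_pdivrMr // mulrC [`|t| * e]mulrC -mulrA [_ * e]mulrC.
  by rewrite ler_wpM2l // ltW.
have Gw : {within `[0, 1], continuous G}.
  apply: continuous_in_subspaceT => r; rewrite inE /= in_itv /=; exact: Gc.
have [c _] := @MVT R G (fun=> 0) 0 1 ltr01 Gd Gw.
have -> : G 1 = L (f w) by rewrite /G /seg ofR1 mul1r subrKC.
have -> : G 0 = L (f z) by rewrite /G /seg ofR0 mul0r addr0.
by rewrite mul0r => /eqP; rewrite subr_eq0 => /eqP ->.
Qed.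

Lemma seg_constant (f : C -> C) z w :
  (forall r, 0 <= r <= 1 -> cont_at f (seg z w r)) ->
  (forall r, 0 < r < 1 -> flat_at f (seg z w r)) -> f z = f w.
Proof.
move=> fc ff; apply: C_eq.
  apply: (seg_constant_part (L := @rpart R)) fc ff => [a b|]; last exact: rpart_le.
  by rewrite rpartD rpartN.
apply: (seg_constant_part (L := @ipart R)) fc ff => [a b|]; last exact: ipart_le.
by rewrite ipartD ipartN.
Qed.

(** On a segment issuing from s0 the point s0 is only an endpoint, so nothing is asked of the
    derivative there. This matters when s0 is a critical point, where tangency gives no
    information. *)
Lemma near_constant (f : C -> C) s0 :
  (\forall s \near s0, derivable f s 1 /\ (s != s0 -> 'D_1 f s = 0)) ->
  \forall s \near s0, f s = f s0.
Proof.
move=> /nearCP[d d0 hd]; apply/nearCP; exists d => // s hs.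
have hseg r : 0 <= r <= 1 -> cmod (seg s0 s r - s0) < d.
  move=> /andP[r0 r1]; rewrite /seg [s0 + _]addrC addrK cmodM cmod_ofR.
  rewrite ger0_norm //; apply: le_lt_trans hs.
  by rewrite ler_piMl // cmod_ge0.
have [->//|ss0] := eqVneq s s0.
apply/esym/seg_constant => r hr.
  by apply: derivable_cont_at; have [] := hd _ (hseg _ hr).
have [r0 r1] := andP hr.
have [|dr hr0] := hd (seg s0 s r); first by apply: hseg; rewrite !ltW.
apply: derivable_flat dr (hr0 _).
rewrite -subr_eq0 /seg [s0 + _]addrC addrK mulf_eq0 negb_or ofR_eq0.
by rewrite (gt_eqF r0) subr_eq0.
Qed.

Lemma finite_avoid (T : choiceType) (f : nat -> T) (S : set T) : injective f ->
  finite_set S -> exists n, ~ S (f n).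
Proof.
move=> finj Sfin; apply: contrapT => H; apply: infinite_nat.
apply: (@sub_finite_set _ _ (f @^-1` S)) => [n _|].
  by apply: contrapT => ns; apply: H; exists n.
by apply: finite_preimage Sfin => x y _ _; exact: finj.
Qed.

(* All but at most two points of the perpendicular bisector of [p, q] are     *)
(* joined to p and q by segments that miss a given point of S.                *)
Lemma locally_constant_cofinite (S : set C) (A : C -> Prop) : finite_set S ->
  (forall s, ~ S s -> \forall t \near s, A t <-> A s) ->
  forall p q, ~ S p -> ~ S q -> A p -> A q.
Proof.
move=> Sfin Aloc p q Sp Sq.
(* The indicator function of [A] is flat off [S], hence constant on every segment missing [S]. *)
pose f s : C := if pselect (A s) then 1 else 0.
have ff s : ~ S s -> flat_at f s.
  move=> /Aloc/nearCP[d d0 hd] e e0; exists d => // h hh.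
  have [|a1 b1] := hd (s + h); first by rewrite addrC addKr.
  rewrite /f; case: pselect => a; case: pselect => b.
  - by rewrite subrr cmod0 mulr_ge0 ?cmod_ge0 // ltW.
  - by case: b; exact: a1.
  - by case: a; exact: b1.
  - by rewrite subrr cmod0 mulr_ge0 ?cmod_ge0 // ltW.
have seg_ok u v : (forall r, 0 <= r <= 1 -> ~ S (seg u v r)) -> f u = f v.
  move=> H; apply: seg_constant => r.
    by move=> /H/ff/flat_cont.
  by move=> /andP[r0 r1]; apply/ff/H; rewrite !ltW.
suff : f p = f q.
  rewrite /f; case: pselect => a; case: pselect => b //= /eqP.
  by rewrite oner_eq0.
have [->//|pq] := eqVneq p q.
(* [m y] runs over the perpendicular bisector; [bad s] collects the y for which the broken path p,
   [m y], q passes through s. *)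
pose m (y : R) : C := (p + q) / 2 + ofR y * (imagC R * (q - p)).
pose bad (s : C) : set R := [set y | exists r, 0 <= r <= 1 /\
   (s = seg p (m y) r \/ s = seg (m y) q r)].
have qp0 : q - p != 0 by rewrite subr_eq0 eq_sym.
(* in the coordinate z |-> (z - p) / (q - p), p = 0, q = 1 and m y = 1/2 + i y *)
have coord z : exists a b : R, z = p + (ofR a + ofR b * imagC R) * (q - p).
  exists (rpart ((z - p) / (q - p))), (ipart ((z - p) / (q - p))).
  have -> : ofR (rpart ((z - p) / (q - p))) + ofR (ipart ((z - p) / (q - p))) * imagC R
     = (z - p) / (q - p).
    by apply: C_eq; rewrite /ofR /rpart /ipart; case: (_ / _) => a b /=; ring.
  by rewrite divfK // subrKC.
have cinj a b a' b' : p + (ofR a + ofR b * imagC R) * (q - p) =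
    p + (ofR a' + ofR b' * imagC R) * (q - p) -> a = a' /\ b = b'.
  move=> /addrI/(mulIf qp0) E; split.
    by have := congr1 (@rpart R) E; rewrite /rpart /ofR /= !(mul0r, mulr0, subr0, addr0).
  by have := congr1 (@ipart R) E; rewrite /ipart /ofR /= !(mul0r, mulr0, subr0, addr0, mulr1, add0r).
have segp y r : seg p (m y) r = p + (ofR (r / 2) + ofR (r * y) * imagC R) * (q - p).
  rewrite /seg /m !ofRM ofRV ofR_nat.
  have : (2 : C) != 0 by rewrite pnatr_eq0.
  by move: (imagC R) (ofR r) (ofR y) => i r' y' h2; field.
have segq y r : seg (m y) q r = p + (ofR (1 - (1 - r) / 2) + ofR ((1 - r) * y) * imagC R) * (q - p).
  rewrite /seg /m !(ofRM, ofRB, ofR1) ofRV ofR_nat.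
  have : (2 : C) != 0 by rewrite pnatr_eq0.
  by move: (imagC R) (ofR r) (ofR y) => i r' y' h2; field.
(* If s has coordinates (a, b), the first segment meets it only for y = b / (2a) and the second only
   for y = b / (2(1 - a)). The degenerate cases r = 0 and r = 1 would put p or q in [S]. *)
have badfin s : S s -> finite_set (bad s).
  move=> Ss; have [a [b sE]] := coord s.
  apply: (@sub_finite_set _ _ [set b / (2 * a); b / (2 * (1 - a))]); last first.
    by rewrite finite_setU; split; exact: finite_set1.
  move=> y [r [_ []]]; rewrite sE ?segp ?segq => /cinj[aE bE].
    left; rewrite aE bE [2 * _]mulrC divfK ?pnatr_eq0 //.
    have [r0|r0] := eqVneq r 0; last by rewrite mulrC mulKf.
    case: Sp; suff <- : s = p by [].
    by rewrite sE aE bE r0 !(mul0r, ofR0, addr0).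
  right; rewrite aE bE subKr [2 * _]mulrC divfK ?pnatr_eq0 //.
  have [r0|r0] := eqVneq (1 - r) 0; last by rewrite mulrC mulKf.
  case: Sq; suff <- : s = q by [].
  by rewrite sE aE bE r0 !(mul0r, subr0, ofR0, ofR1, addr0, mul1r) subrKC.
have Bfin : finite_set (\bigcup_(s in S) bad s) by exact: bigcup_finite.
have natr_inj : injective (fun n : nat => n%:R : R).
  by move=> n n' /eqP; rewrite eqr_nat => /eqP.
have [n] := finite_avoid natr_inj Bfin; move: (n%:R : R) => y ny.
have H1 : f p = f (m y).
  apply: seg_ok => r hr Ss; apply: ny; exists (seg p (m y) r) => //.
  by exists r; split => //; left.
rewrite H1; apply: seg_ok => r hr Ss; apply: ny; exists (seg (m y) q r) => //.
by exists r; split => //; right.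
Qed.
End Constancy.

(** * Minima on the Riemann sphere *)

Section RiemannSphere.
Variable R : realType.
Local Notation C := (Cx R).
Implicit Types (z w s t v : C).

(** A step h = - tau (f s - v) / f'(s) replaces f s - v by (1 - tau)(f s - v), up to an error of
    modulus at most tau |f s - v| / 2; so |f - v| strictly decreases. *)
Lemma derivable_not_local_min (f : C -> C) s v :
  derivable f s 1 -> 'D_1 f s != 0 -> f s != v ->
  ~ \forall t \near s, cmod (f s - v) <= cmod (f t - v).
Proof.
move=> df D0 fv /nearCP[d d0 hd].
have a0 : 0 < cmod (f s - v) by rewrite cmod_gt0 subr_eq0.
have Dp : 0 < cmod ('D_1 f s) by rewrite cmod_gt0.
have [|d' d'0 hd'] := derivable_approx df (e := cmod ('D_1 f s) / 2).
  by rewrite divr_gt0.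
pose rho := cmod (f s - v) / cmod ('D_1 f s).
have rho0 : 0 < rho by rewrite divr_gt0.
have m0 : 0 < Num.min d d' by rewrite lt_min d0 d'0.
(* |h| = tau rho, so this bound keeps |h| at most half of both radii, while tau <= 1 keeps 1 - tau
   nonnegative. *)
pose tau := Num.min 1 (Num.min d d' / (2 * rho)).
have tau0 : 0 < tau.
  by rewrite lt_min ltr01 /=; apply: divr_gt0 => //; exact: mulr_gt0.
have tau1 : tau <= 1 by rewrite ge_min lexx.
pose h : C := - (ofR tau * ((f s - v) / 'D_1 f s)).
have hE : cmod h = tau * rho.
  by rewrite cmodN !cmodM cmodV cmod_ofR gtr0_norm.
have hlt : cmod h < Num.min d d'.
  rewrite hE; apply: (@le_lt_trans _ _ (Num.min d d' / (2 * rho) * rho)).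
    by apply: ler_wpM2r; [exact: ltW | rewrite /tau ge_min lexx orbT].
  have -> : Num.min d d' / (2 * rho) * rho = Num.min d d' / 2.
    by field; rewrite gt_eqF.
  by rewrite ltr_pdivrMr // ltr_pMr // ltr1n.
move: hlt; rewrite lt_min => /andP[h1 /hd' H2].
have := hd (s + h); rewrite addrC addKr => /(_ h1).
apply/negP; rewrite -ltNge.
have -> : f (s + h) - v = ofR (1 - tau) * (f s - v) + (f (s + h) - f s - 'D_1 f s * h).
  have -> : 'D_1 f s * h = - (ofR tau * (f s - v)) by rewrite /h; field.
  by rewrite ofRB ofR1; ring.
apply: le_lt_trans (cmodD _ _) _; apply: le_lt_trans (lerD (lexx _) H2) _.
rewrite cmodM cmod_ofR ger0_norm ?subr_ge0 // hE /rho.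
have -> : cmod ('D_1 f s) / 2 * (tau * (cmod (f s - v) / cmod ('D_1 f s))) =
   tau * cmod (f s - v) / 2 by field; rewrite gt_eqF.
have key (x y : R) : 0 < x -> y - x + x / 2 < y by lra.
by rewrite mulrBl mul1r; apply: key; rewrite mulr_gt0.
Qed.

(** The two closed unit discs |s| <= 1 and |1/s| <= 1 cover the sphere, and each lies in the compact
    square [-1, 1]^2 of its chart. Continuity is stated chart by chart because [P1] carries no
    topology. *)
Lemma P1_min (H : P1 R -> R) :
  (forall s e, 0 < e -> \forall t \near s, `|H (P1_zero t) - H (P1_zero s)| < e) ->
  (forall s e, 0 < e -> \forall t \near s, `|H (P1_infty t) - H (P1_infty s)| < e) ->
  exists p, forall q, H p <= H q.
Proof.
pose sq : set (R * R) := `[-1, 1] `*` `[-1, 1].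
have sqc : compact sq by apply: compact_setX; exact: segment_compact.
pose g (p : R * R) : C := p.1 +i* p.2.
have chart_min (G : C -> R) :
  (forall s e, 0 < e -> \forall t \near s, `|G t - G s| < e) ->
  exists s, forall t, cmod t <= 1 -> G s <= G t.
  move=> Gc.
  have [||[x y] _ hm] := compact_EVT_min (f := G \o g) (A := sq) _ sqc.
  - by exists (0, 0); split; rewrite /= in_itv /= lerN10 ler01.
  - apply: continuous_subspaceT => -[x y]; apply/(@cvgrPdist_lt _ R^o) => e /(Gc (g (x, y))).
    move=> /nearCP[d d0 hd]; exists (ball x (d / 2), ball y (d / 2)).
      by split; apply: nbhsx_ballx; rewrite divr_gt0.
    move=> [x' y'] [/= hx hy]; rewrite /= distrC; apply: hd.
    apply: le_lt_trans (cmod_le _) _; rewrite /rpart /ipart /=.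
    rewrite [`|x' - x|]distrC [`|y' - y|]distrC [d]splitr; exact: ltrD.
  exists (g (x, y)) => t ht.
  have -> : G t = (G \o g) (rpart t, ipart t) by rewrite /g /= /rpart /ipart; case: t {ht}.
  apply: hm; rewrite inE; split; rewrite /= in_itv /= -ler_norml.
    exact: le_trans (rpart_le _) ht.
  exact: le_trans (ipart_le _) ht.
move=> /chart_min[s0 h0] /chart_min[s1 h1].
have all q : H (P1_zero s0) <= H q \/ H (P1_infty s1) <= H q.
  case: q => [s|]; last first.
    right; have -> : None = P1_infty (0 : C) by rewrite /P1_infty eqxx.
    by apply: h1; rewrite cmod0.
  have [s_le1|s_gt1] := lerP (cmod s) 1; first by left; exact: h0.
  have sn0 : s != 0 by rewrite -cmod_gt0 (lt_trans ltr01).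
  right; have -> : Some s = P1_infty s^-1.
    by rewrite /P1_infty invr_eq0 (negbTE sn0) invrK.
  by apply: h1; rewrite cmodV invf_le1 ?(lt_trans ltr01) // ltW.
have [le01|le10] := lerP (H (P1_zero s0)) (H (P1_infty s1)).
  by exists (P1_zero s0) => q; case: (all q) => // /(le_trans le01).
by exists (P1_infty s1) => q; case: (all q) => // /(le_trans (ltW le10)).
Qed.

(* The discs |v - x| < |v| say that v / x has real part > 1/2; such quotients *)
(* generate the multiplicative group.                                         *)
Lemma disc_chain (V : C -> Prop) (x0 : C) : x0 != 0 -> V x0 ->
  (forall x v, V x -> x != 0 -> v != 0 -> cmod (x - v) < cmod v -> V v) ->
  forall v, v != 0 -> V v.
Proof.
move=> x00 Vx0 Vstep.
have half (x a : C) : V x -> x != 0 -> 1 / 2 < rpart a -> V (a * x).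
  move=> Vx xn0 ha.
  have a0 : a != 0 by apply/eqP => a0; move: ha; rewrite a0 /rpart /=; lra.
  apply: (Vstep _ _ Vx xn0 (mulf_neq0 a0 xn0)).
  rewrite -{1}[x]mul1r -mulrBl !cmodM ltr_pM2r ?cmod_gt0 //.
  rewrite -(ltr_pXn2r (n := 2)) ?nnegrE ?cmod_ge0 // !cmod_sqr.
  rewrite rpartD ipartD rpartN ipartN.
  have -> : rpart (1 : C) = 1 by []. have -> : ipart (1 : C) = 0 by [].
  by nra.
have half_real (x : C) (r : R) : V x -> x != 0 -> 1 / 2 < r -> V (ofR r * x).
  by move=> Vx xn0 hr; apply: half.
(* Any r > 1/(n + 2) is reached by splitting off factors 3/5: the factor exceeds 1/2, and (5/3)(n +
   2) >= n + 3 makes the induction go through. *)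
have real_step n : forall (x : C) (r : R), V x -> x != 0 -> 1 < r * (n.+2)%:R -> V (ofR r * x).
  elim: n => [|n IH] x r Vx xn0 hr; first by apply: half_real => //; lra.
  have -> : ofR r * x = ofR (3 / 5) * (ofR (r * (5 / 3)) * x).
    by rewrite mulrA -ofRM; congr (ofR _ * _); field.
  have n0 : 0 <= n%:R :> R by rewrite ler0n.
  have r0 : 0 < r by rewrite -(pmulr_lgt0 r (x := n.+3%:R)) ?ltr0n // (lt_trans ltr01).
  apply: half_real; last by lra.
    apply: IH => //; have rn : 0 <= r * n%:R by rewrite mulr_ge0 // ltW.
    move: hr; rewrite -[n.+3]addn3 -[n.+2]addn2 !natrD; move: (n%:R : R) rn => N rn hr.
    have -> : r * (5 / 3) * (N + 2) = r * (N + 3) + (r * N * (2 / 3) + r / 3) by field.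
    apply: ltr_wpDr => //; apply: addr_ge0; last by rewrite divr_ge0 // ltW.
    by apply: mulr_ge0 => //; rewrite divr_ge0.
  by rewrite mulf_neq0 // ofR_eq0 mulf_neq0 ?gt_eqF // divr_gt0.
have real_mul (x : C) (r : R) : V x -> x != 0 -> 0 < r -> V (ofR r * x).
  move=> Vx xn0 r0; have := @archi_boundP R r^-1.
  rewrite invr_ge0 ltW // => /(_ isT); set n := Num.bound _ => hn.
  apply: (@real_step n) => //; rewrite -ltr_pdivrMl // mulr1.
  by apply: lt_le_trans hn _; rewrite ler_nat; do 2!apply: leqW.
have right_mul (x a : C) : V x -> x != 0 -> 0 < rpart a -> V (a * x).
  move=> Vx xn0 ra.
  pose b : C := 1 +i* (ipart a / rpart a).
  have -> : a * x = ofR (rpart a) * (b * x).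
    rewrite mulrA; congr (_ * _); apply: C_eq.
      by rewrite rpart_ofRM [rpart b]/= mulr1.
    by rewrite ipart_ofRM [ipart b]/= mulrC divfK // gt_eqF.
  have hb : 1 / 2 < rpart b by rewrite [rpart b]/=; lra.
  apply: real_mul ra; first exact: half.
  by rewrite mulf_neq0 //; apply/eqP => b0; move: hb; rewrite b0 /rpart /=; lra.
(* i = (1 + i)^2 / 2, and 1 + i has positive real part. *)
have i_mul (x : C) : V x -> x != 0 -> V (imagC R * x).
  move=> Vx xn0; pose b : C := 1 +i* 1.
  have b0 : b != 0 by apply/eqP => /(congr1 (@rpart R))/eqP; rewrite oner_eq0.
  have -> : imagC R * x = ofR (1 / 2) * (b * (b * x)).
    rewrite !mulrA; congr (_ * _); apply: C_eq; rewrite /rpart /ipart /= ?mul0r; by field.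
  apply: real_mul; [|by rewrite !mulf_neq0|by rewrite divr_gt0].
  by do 2!(apply: (right_mul); rewrite ?mulf_neq0 ?ltr01 //).
have ii : imagC R * imagC R = -1.
  by apply: C_eq; rewrite /rpart /ipart /=; ring.
have i0 : imagC R != 0.
  by apply/eqP => /(congr1 (@ipart R))/eqP; rewrite oner_eq0.
(* Some power of i rotates q into the right half plane, where [right_mul] applies; the remaining
   powers of i bring it back. *)
move=> v v0; pose q := v / x0.
have vE : v = q * x0 by rewrite divfK.
have q0 : q != 0 by rewrite mulf_neq0 ?invr_eq0.
have [rq|rq|rq] := ltrgtP (rpart q) 0.
- have nq0 : - q != 0 by rewrite oppr_eq0.
  have Vy : V (- q * x0) by apply: right_mul; rewrite // rpartN oppr_gt0.
  have y0 := mulf_neq0 nq0 x00.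
  have -> : v = imagC R * (imagC R * (- q * x0)).
    by rewrite vE mulrA ii mulN1r mulNr opprK.
  exact: i_mul (i_mul _ Vy y0) (mulf_neq0 i0 y0).
- by rewrite vE; exact: right_mul.
have iq0 := mulf_neq0 i0 q0.
have [iq|iq|iq] := ltrgtP (ipart q) 0.
- have Vy : V (imagC R * q * x0) by apply: right_mul; rewrite // rpart_i oppr_gt0.
  have y0 := mulf_neq0 iq0 x00.
  have -> : v = imagC R * (imagC R * (imagC R * (imagC R * q * x0))).
    by rewrite vE !mulrA ii -!mulrA [imagC R * (imagC R * _)]mulrA ii !mulN1r opprK.
  have Vi := i_mul _ Vy y0; have yi := mulf_neq0 i0 y0.
  exact: i_mul (i_mul _ Vi yi) (mulf_neq0 i0 yi).
- have Vy : V (- (imagC R * q) * x0).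
    by apply: right_mul; rewrite // rpartN rpart_i opprK.
  have -> : v = imagC R * (- (imagC R * q) * x0).
    by rewrite vE mulrA mulrN mulrA ii mulN1r opprK.
  by apply: i_mul Vy _; rewrite mulf_neq0 // oppr_eq0.
by case/eqP: q0; exact: C_eq.
Qed.
End RiemannSphere.

(** * Periods *)

Lemma derive_cubic (K : numFieldType) (a b c d s : K) :
  is_derive s 1 (fun t : K => a * t ^+ 3 + b * t ^+ 2 + c * t + d)
    (3 * a * s ^+ 2 + 2 * b * s + c).
Proof.
have H := is_derive_id s (1 : K).
have -> : (fun t : K => a * t ^+ 3 + b * t ^+ 2 + c * t + d) =
  a *: ((@id K) ^+ 3) + b *: ((@id K) ^+ 2) + c *: (@id K) + cst d.
  by apply/funext => t /=; rewrite !fctE.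
have H3 := is_deriveZ a (is_deriveX 3 H).
have H2 := is_deriveZ b (is_deriveX 2 H).
have H1 := is_deriveZ c H.
have H0 := is_derive_cst d s (1 : K).
apply: (is_derive_eq (is_deriveD (is_deriveD (is_deriveD H3 H2) H1) H0)).
rewrite /GRing.scale /= !mulr1 addr0; ring.
Qed.

Lemma derive_quadratic (K : numFieldType) (b c d s : K) :
  is_derive s 1 (fun t : K => b * t ^+ 2 + c * t + d) (2 * b * s + c).
Proof.
have := derive_cubic 0 b c d s.
rewrite mulr0 mul0r add0r.
by under eq_fun => t do rewrite mul0r add0r.
Qed.

Section Periods.
Variable R : realType.
Local Notation C := (Cx R).

Lemma two_neq0 : (2 : C) != 0. Proof. by rewrite pnatr_eq0. Qed.
Lemma six_neq0 : (6 : C) != 0. Proof. by rewrite pnatr_eq0. Qed.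

Lemma pderiv1_Psi0 : pderiv1 (Psi0 R) =
  fun z => ((z.1 + 5 * imagC R) ^+ 2 + 2 * z.1 * z.2 + z.2 ^+ 2) / 2.
Proof.
apply/funext => -[x y]; rewrite /pderiv1 /Psi0 /=.
have h2 := two_neq0; have h6 := six_neq0.
move: (imagC R) => i.
have -> : (fun t : C => ((t + 5 * i) ^+ 3 + (y + 5 * i) ^+ 3 + 3 * t ^+ 2 * y + 3 * t * y ^+ 2) / 6) =
  fun t => (1 / 6) * t ^+ 3 + ((5 * i + y) / 2) * t ^+ 2 + ((25 * i ^+ 2 + y ^+ 2) / 2) * t +
    ((5 * i) ^+ 3 + (y + 5 * i) ^+ 3) / 6.
  by apply/funext => t; field; rewrite ?h2 ?h6.
have D := derive_cubic (1 / 6) ((5 * i + y) / 2) ((25 * i ^+ 2 + y ^+ 2) / 2) (((5 * i) ^+ 3 + (y + 5 * i) ^+ 3) / 6) x.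
by rewrite (@derive_val _ _ _ _ _ _ _ D); field; rewrite ?h2 ?h6.
Qed.

Lemma pderiv11_Psi0 z : pderiv1 (pderiv1 (Psi0 R)) z = z.1 + z.2 + 5 * imagC R.
Proof.
rewrite pderiv1_Psi0 /pderiv1 /=; case: z => x y /=.
have h2 := two_neq0; move: (imagC R) => i.
have -> : (fun t : C => ((t + 5 * i) ^+ 2 + 2 * t * y + y ^+ 2) / 2) =
  fun t => (1 / 2) * t ^+ 2 + (5 * i + y) * t + ((5 * i) ^+ 2 + y ^+ 2) / 2.
  by apply/funext => t; field.
have D := derive_quadratic (1 / 2) (5 * i + y) (((5 * i) ^+ 2 + y ^+ 2) / 2) x.
by rewrite (@derive_val _ _ _ _ _ _ _ D); field.
Qed.

Lemma pderiv21_Psi0 z : pderiv2 (pderiv1 (Psi0 R)) z = z.1 + z.2.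
Proof.
rewrite pderiv1_Psi0 /pderiv2 /=; case: z => x y /=.
have h2 := two_neq0; move: (imagC R) => i.
have -> : (fun t : C => ((x + 5 * i) ^+ 2 + 2 * x * t + t ^+ 2) / 2) =
  fun t => (1 / 2) * t ^+ 2 + x * t + (x + 5 * i) ^+ 2 / 2.
  by apply/funext => t; field.
have D := derive_quadratic (1 / 2) x ((x + 5 * i) ^+ 2 / 2) y.
by rewrite (@derive_val _ _ _ _ _ _ _ D); field.
Qed.

(** The only periods that must be evaluated: F_2 merely rescales the coordinates on the lines and
    does not affect which lines are identified. *)
Lemma F1_Psi0 g (x : C) : F1 (Psi0 R) g (x, 0) =
  (g.1 + g.2)%:~R * x + (5 * g.1)%:~R * imagC R.
Proof.
rewrite /F1 pderiv11_Psi0 pderiv21_Psi0 /= !addr0 rmorphM /= rmorphD /=.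
by move: (imagC R) => i; ring.
Qed.

Lemma sin_pi_int (n : nat) (t : R) :
  sin (trigo.pi * t) = 0 -> sin (trigo.pi * (t - n%:R)) = 0 /\ sin (trigo.pi * (t + n%:R)) = 0.
Proof.
move=> h; elim: n => [|n [IH1 IH2]]; first by rewrite subr0 addr0.
rewrite -natr1; split.
  have -> : trigo.pi * (t - (n%:R + 1)) = trigo.pi * (t - n%:R) - trigo.pi :> R by ring.
  by rewrite sinB cospi sinpi IH1; ring.
have -> : trigo.pi * (t + (n%:R + 1)) = trigo.pi * (t + n%:R) + trigo.pi :> R by ring.
by rewrite sinDpi IH2 oppr0.
Qed.

Lemma cos_sin_nat (n : nat) : cos (2 * trigo.pi * n%:R) = 1 :> R /\ sin (2 * trigo.pi * n%:R) = 0 :> R.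
Proof.
elim: n => [|n [IH1 IH2]]; first by rewrite mulr0 cos0 sin0.
have -> : 2 * trigo.pi * n.+1%:R = 2 * trigo.pi * n%:R + 2 * trigo.pi :> R by rewrite -natr1; ring.
rewrite cosD sinD IH1 IH2.
have -> : 2 * trigo.pi = trigo.pi *+ 2 :> R by rewrite mulr_natl.
by rewrite cos2pi sin2pi; split; ring.
Qed.

Lemma cexp_2pi_int (n : int) : cexp (two_pi_i R * n%:~R) = 1.
Proof.
suff H (m : nat) : cexp (two_pi_i R * m%:R) = 1.
  case: n => m; first exact: H.
  rewrite NegzE mulrNz mulrN.
  by rewrite -[LHS]mul1r -{1}(H m.+1) -cexpD subrr cexp0.
rewrite -ofR_nat /cexp /=.
have -> : 0 * m%:R - 2 * trigo.pi * 0 = 0 :> R by ring.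
have -> : 0 * 0 + 2 * trigo.pi * m%:R = 2 * trigo.pi * m%:R :> R by ring.
rewrite expR0 !mul1r.
by have [-> ->] := cos_sin_nat m.
Qed.

(** The modulus exp(- 2 pi Im z) must be 1, so z is a real a; then cos(2 pi a) = 1 gives sin(pi a) =
    0, and sin is positive on (0, pi), so the fractional part of a vanishes. *)
Lemma cexp_2pi_eq1 (z : C) : cexp (two_pi_i R * z) = 1 <-> exists n : int, z = n%:~R.
Proof.
split; last by case=> n ->; exact: cexp_2pi_int.
have pi0 := pi_gt0 R.
case: z => a b; rewrite /cexp /=.
have -> : 0 * a - 2 * trigo.pi * b = - (2 * trigo.pi * b) by ring.
have -> : 0 * b + 2 * trigo.pi * a = 2 * trigo.pi * a by ring.
set u := expR _ => -[H1 H2].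
have u0 : u != 0 by rewrite gt_eqF // expR_gt0.
have S0 : sin (2 * trigo.pi * a) = 0.
  by move/eqP: H2; rewrite mulf_eq0 (negbTE u0) => /eqP.
have C2 := cos2Dsin2 (2 * trigo.pi * a); rewrite S0 expr0n addr0 in C2.
have u1 : u = 1.
  have : u ^+ 2 = 1 by rewrite -[RHS](expr1n _ 2) -H1 exprMn C2 mulr1.
  move=> /eqP; rewrite sqrf_eq1 => /orP[/eqP//|/eqP uN].
  by have := expR_gt0 (- (2 * trigo.pi * b)); rewrite -/u uN; lra.
have b0 : b = 0.
  have : - (2 * trigo.pi * b) = 0 by apply: expR_inj; rewrite -/u u1 expR0.
  by move=> /eqP; rewrite oppr_eq0 !mulf_eq0 pnatr_eq0 (gt_eqF pi0) => /eqP.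
have C1 : cos (2 * trigo.pi * a) = 1 by move: H1; rewrite u1 mul1r.
have Sp : sin (trigo.pi * a) = 0.
  have E : 2 * trigo.pi * a = trigo.pi * a + trigo.pi * a by ring.
  move: C1; rewrite E cosD => H; have := cos2Dsin2 (trigo.pi * a).
  by move: (sin _) (cos _) H => x y; rewrite -!expr2 => H ?; apply/eqP; rewrite -sqrf_eq0; apply/eqP; lra.
exists (Num.floor a); rewrite b0.
have Sf : sin (trigo.pi * (a - (Num.floor a)%:~R)) = 0.
  case: (Num.floor a) => n; first by have [] := sin_pi_int n Sp.
  by rewrite NegzE mulrNz opprK; have [] := sin_pi_int n.+1 Sp.
have h1 : 0 <= a - (Num.floor a)%:~R by rewrite subr_ge0 floor_le.
have h2 : a - (Num.floor a)%:~R < 1 by rewrite ltrBlDl; have := floorD1_gt a; rewrite intrD.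
suff : a - (Num.floor a)%:~R = 0.
  by move=> /eqP; rewrite subr_eq0 => /eqP {1}->; rewrite -ofR_int.
apply/eqP; move: h1; rewrite le_eqVlt eq_sym => /orP[//|h1].
have := @sin_gt0_pi R (trigo.pi * (a - (Num.floor a)%:~R)).
by rewrite mulr_gt0 //= Sf gtr_pMr // h2 ltxx => /(_ isT).
Qed.

End Periods.

(** * The chain of lines in E over z2 = 0 *)

Section ChainE.
Variable R : realType.
Local Notation C := (Cx R).
Implicit Types (s t : P1 R).

(* On z_2 = 0, the x_n-axis and the y_(n+1)-axis form the n-th line C_n of    *)
(* the chain, with affine coordinate x_n; s = infty on C_n is s = 0 on        *)
(* C_(n+1).                                                                   *)
Definition chain_pt (n : int) s : E R :=
  if s is Some x then Ept n x 0 else Ept (n + 1) 0 0.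

Definition chain_nf (n : int) s : int * P1 R :=
  if s is Some x then (n, Some x) else (n + 1, Some 0).

(** A gluing-invariant normal form that separates the points of the chain: each node is recorded as
    0 on the line that starts there. [(0, None)] is a dummy value for points off the axes. *)
Definition axis_nf (p : Epre R) : int * P1 R :=
  let: (k, (x, y)) := p in
  if y == 0 then (k, Some x) else if x == 0 then (k - 1, Some y^-1) else (0, None).

Lemma axis_nf_pt k (x y : C) : axis_nf (repr (Ept k x y)) = axis_nf (k, (x, y)).
Proof.
rewrite /Ept; apply: glued_inv => _ _ [j a b a0] /=.
rewrite invr_eq0 !mulf_eq0 (negbTE a0) /= addrK invrK.
by case: eqP.
Qed.

Lemma axis_nf_chain n s : axis_nf (repr (chain_pt n s)) = chain_nf n s.
Proof. by case: s => [x|]; rewrite axis_nf_pt /= eqxx. Qed.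

Lemma chain_ptP n s n' s' : chain_pt n s = chain_pt n' s' <->
  [\/ n = n' /\ s = s', [/\ n' = n + 1, s = None & s' = Some 0] |
     [/\ n = n' + 1, s = Some 0 & s' = None]].
Proof.
split; last first.
  by case=> [[-> ->//]|[-> -> ->//]|[-> -> ->//]].
move=> /(congr1 (fun e => axis_nf (repr e))); rewrite !axis_nf_chain.
case: s s' => [x|] [x'|] /=.
- by case=> -> ->; constructor 1.
- by case=> -> ->; constructor 3.
- by case=> <- <-; constructor 2.
- by case=> /addIr -> ; constructor 1.
Qed.

Lemma Ept_yaxis k (y : C) : y != 0 -> Ept k 0 y = Ept (k - 1) y^-1 0.
Proof.
move=> y0; apply/pi_E_eq; apply: rst_sym; apply: rst_step.
have := @Glue R (k - 1) y^-1 0; rewrite mulr0 invrK subrK; apply.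
by rewrite invr_eq0.
Qed.

Lemma z2E_chain n s : z2E (chain_pt n s) = 0.
Proof. by case: s => [x|]; rewrite z2E_pt mulr0. Qed.

Definition scaleP1 (c : C) s : P1 R := omap (fun x => c * x) s.

Lemma scaleP11 s : scaleP1 1 s = s.
Proof. by case: s => [x|] //=; rewrite mul1r. Qed.

Lemma act_chain m (a : C) n s : a != 0 ->
  actE m a (chain_pt n s) = chain_pt (n + m) (scaleP1 a^-1 s).
Proof. by move=> a0; case: s => [x|] /=; rewrite actE_pt // !mulr0 // addrAC. Qed.

Definition node (e : E R) : Prop := exists k, e = Ept k 0 0.

(** The origin of a chart is glued to nothing else: gluing requires x nonzero and produces y = 1/x
    nonzero. *)
Lemma node_pt k (x y : C) : node (Ept k x y) <-> x = 0 /\ y = 0.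
Proof.
split; last by case=> -> ->; exists k.
case=> k' /pi_E_eq.
pose h (p : Epre R) := (p.2.1 == 0) && (p.2.2 == 0).
have H q r : clos_refl_sym_trans _ (@Defs.glue R) q r -> h q = h r.
  elim=> [_ _ [j a b a0]|//|? ? _ ->//|? ? ? _ -> _ ->//].
  by rewrite /h /= invr_eq0 (negbTE a0) /= andbF.
by move=> /H; rewrite /h /= eqxx => /andP[/eqP -> /eqP ->].
Qed.

Lemma node_act m (a : C) (e : E R) : a != 0 -> node e -> node (actE m a e).
Proof.
by move=> a0 [k ->]; exists (k + m); rewrite actE_pt // !mulr0.
Qed.

Lemma node_chain n s : node (chain_pt n s) <-> s = Some 0 \/ s = None.
Proof.
case: s => [x|] /=; last by split=> _; [right|exists (n + 1)].
by rewrite node_pt; split=> [[-> _]|[[->]|//]]; [left|].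
Qed.

End ChainE.

(** * The fibre of M over (z1, 0) *)

Section Fibre.
Variables (R : realType) (eps : R) (z1 : Cx R).
Hypotheses (heps : eps <= 1) (hz : in_polydisk eps (z1, 0)).
Local Notation C := (Cx R).
Local Notation Psi := (Psi0 R).
Local Notation M := (M Psi eps).
Local Notation b := ((z1, 0) : C * C).
Implicit Types (g h : int * int) (w : C) (s t : P1 R).

(** The multipliers of g over (z1, 0): w goes to [qmul g * w], while by [act_chain] a line
    coordinate x goes to [(rmul g)^-1 * x]. *)
Definition qmul g : C := cexp (two_pi_i R * F1 Psi g b).
Definition rmul g : C := cexp (two_pi_i R * F2 Psi g b).

Lemma qmul_neq0 g : qmul g != 0. Proof. exact: cexp_neq0. Qed.
Lemma rmul_neq0 g : rmul g != 0. Proof. exact: cexp_neq0. Qed.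

Lemma qmulD g h : qmul (g.1 + h.1, g.2 + h.2) = qmul g * qmul h.
Proof.
rewrite /qmul -cexpD -mulrDr; congr (cexp (_ * _)); rewrite /F1.
move: (pderiv1 _ _) (pderiv2 _ _) => x y.
by rewrite !intrD !mulrDl addrACA.
Qed.

Lemma qmul0 : qmul (0, 0) = 1.
Proof. by rewrite /qmul F1_Psi0 /= addr0 mulr0 !mul0r addr0 mulr0 cexp0. Qed.

Lemma rmul0 : rmul (0, 0) = 1.
Proof.
rewrite /rmul /F2; move: (pderiv1 _ _) (pderiv2 _ _) => x y.
by rewrite /= !mul0r addr0 mulr0 cexp0.
Qed.

Lemma qmulN g : qmul (- g.1, - g.2) = (qmul g)^-1.
Proof.
apply: (mulfI (qmul_neq0 g)); rewrite -qmulD /= !subrr qmul0 divff //.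
exact: qmul_neq0.
Qed.

Lemma ipart_z1 : `|ipart z1| < 1.
Proof.
apply: le_lt_trans (ipart_le _) _; move: hz; rewrite /in_polydisk /= => /andP[+ _].
by rewrite normE ltr_ofR => /lt_le_trans; apply.
Qed.

Lemma qmul_eq1 g : qmul g = 1 <->
  exists n : int, (g.1 + g.2)%:~R * z1 + (5 * g.1)%:~R * imagC R = n%:~R.
Proof. by rewrite /qmul F1_Psi0 cexp_2pi_eq1. Qed.

(** F_1 = j (z1 + 5 i) has imaginary part j (Im z1 + 5), nonzero unless j = 0 because |Im z1| < 1.
    Hence an element that fixes w and does not shift the chain is trivial. *)
Lemma qmul_inj (j : int) : qmul (j, 0) = 1 -> j = 0.
Proof.
move/qmul_eq1 => [n /=]; rewrite addr0 intrM -!ofR_int => /(congr1 (@ipart R)).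
rewrite ipartD ipart_ofRM -ofRM ipart_ofRM [ipart (imagC R)]/= [ipart (ofR n%:~R)]/=.
rewrite mulr1 [_%:~R * j%:~R]mulrC -mulrDr => /eqP; rewrite mulf_eq0 intr_eq0.
move=> /orP[/eqP//|]; have := ipart_z1; rewrite ltr_norml => /andP[h1 h2].
by move=> /eqP h; exfalso; move: h; have -> : 5%:~R = 5 :> R by []; lra.
Qed.

Lemma base_in_tM w (e : E R) : w != 0 -> z2E e = 0 -> in_tM eps (z1, w, e).
Proof. by move=> w0 e0; rewrite /in_tM /base /= w0 e0. Qed.

(** Only a default for [insubd], which lets [Mpt] be total. *)
Definition tM0 : tM eps :=
  exist _ (z1, 1, Ept 0 0 0) (base_in_tM (oner_neq0 _) (z2E_chain 0 (Some 0))).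

Definition Mpt w (e : E R) : M := \pi_M (insubd tM0 (z1, w, e)).

Lemma val_Mpt w e : w != 0 -> z2E e = 0 ->
  val (insubd tM0 (z1, w, e)) = (z1, w, e).
Proof. by move=> w0 e0; rewrite insubdK //; exact: base_in_tM. Qed.

Lemma Mpt_eq w e w' e' : w != 0 -> z2E e = 0 -> w' != 0 -> z2E e' = 0 ->
  Mpt w e = Mpt w' e' <-> exists g, w' = qmul g * w /\ e' = actE g.2 (rmul g) e.
Proof.
move=> w0 e0 w0' e0'; rewrite /Mpt pi_M_eq; split.
  case=> g /(congr1 val); rewrite val_Mpt //= val_Mpt // => -[-> ->]; exists g.
  by rewrite /base /= e0.
case=> g [hw he]; exists g; apply: val_inj; rewrite val_Mpt //= val_Mpt //.
by rewrite /act_raw /base /= e0 hw he.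
Qed.

Lemma fibr_Mpt w e : w != 0 -> z2E e = 0 -> fibr (Mpt w e) = b.
Proof. by move=> w0 e0; rewrite /Mpt fibr_pi val_Mpt // /base /= e0. Qed.

Lemma has_coords_fibr k v (m : M) : fibr m = b -> has_coords k v m ->
  [/\ crd v 0 = z1, crd v 1 != 0, crd v 2 * crd v 3 = 0 &
      m = Mpt (crd v 1) (Ept k (crd v 2) (crd v 3))].
Proof.
move=> hm [p pE mE]; move: hm; rewrite mE fibr_pi pE /base /= z2E_pt => -[zE xy].
have w0 : crd v 1 != 0 by have /andP[] := valP p; rewrite pE.
split => //; congr (\pi_M _); apply: val_inj.
by rewrite val_Mpt // ?z2E_pt // -zE.
Qed.

Lemma has_coords_Mpt k v : crd v 0 = z1 -> crd v 1 != 0 -> crd v 2 * crd v 3 = 0 ->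
  has_coords k v (Mpt (crd v 1) (Ept k (crd v 2) (crd v 3))).
Proof.
move=> zE w0 xy; exists (insubd tM0 (z1, crd v 1, Ept k (crd v 2) (crd v 3))) => //.
by rewrite val_Mpt ?z2E_pt // zE.
Qed.

Definition vec4 (a0 a1 a2 a3 : C) : 'rV[C]_4 := \row_i [:: a0; a1; a2; a3]`_i.

Lemma crd_vec4 a0 a1 a2 a3 :
  [/\ crd (vec4 a0 a1 a2 a3) 0 = a0, crd (vec4 a0 a1 a2 a3) 1 = a1,
     crd (vec4 a0 a1 a2 a3) 2 = a2 & crd (vec4 a0 a1 a2 a3) 3 = a3].
Proof. by split; rewrite /crd mxE inordK. Qed.

(** dz1 and dz2 = y dx + x dy are dependent only where dz2 vanishes, at a node. Criticality asks for
    some coordinates of m; passing to the given ones is possible because gluing and the group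
    preserve nodes. *)
Lemma critical_coords (m : M) k v : has_coords k v m ->
  (critical m <-> crd v 2 = 0 /\ crd v 3 = 0).
Proof.
have coordsE k' v' : has_coords k' v' m -> exists2 e, e = Ept k' (crd v' 2) (crd v' 3) &
  exists2 p : tM eps, (val p).2 = e & m = \pi_M p.
  by move=> [p pE mE]; exists (Ept k' (crd v' 2) (crd v' 3)) => //; exists p; rewrite ?pE.
move=> hv; split; last first.
  move=> [x0 y0]; exists k, v; split => //; exists (0, 1); split.
    by apply/eqP => -[/eqP]; rewrite oner_eq0.
  by move=> a; rewrite /dz2 /= x0 y0 !mul0r addr0 mulr0 add0r.
case=> k' [v' [hv' [c [c0 hc]]]].
have := hc (vec4 1 0 0 0); have := hc (vec4 0 0 1 0); have := hc (vec4 0 0 0 1).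
rewrite /dz1 /dz2; have [-> _ -> ->] := crd_vec4 0 0 0 1.
have [-> _ -> ->] := crd_vec4 0 0 1 0; have [-> _ -> ->] := crd_vec4 1 0 0 0.
rewrite !(mulr0, mulr1, add0r, addr0) => c2x c2y c1.
have c2 : c.2 != 0 by apply: contraNneq c0 => c2; rewrite [c]surjective_pairing c1 c2.
have x0 : crd v' 2 = 0 by apply: (mulfI c2); rewrite c2x mulr0.
have y0 : crd v' 3 = 0 by apply: (mulfI c2); rewrite c2y mulr0.
have [e eE [p pE mE]] := coordsE _ _ hv.
have [e' eE' [p' pE' mE']] := coordsE _ _ hv'.
have /pi_M_eq[g gE] : \pi_M p' = \pi_M p by rewrite -mE -mE'.
apply/(@node_pt _ k); rewrite -eE -pE gE /= pE' eE'.
by apply: node_act; rewrite ?cexp_neq0 // x0 y0; exists k'.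
Qed.

Lemma critical_Mpt w e : w != 0 -> z2E e = 0 -> critical (Mpt w e) <-> node e.
Proof.
move=> w0; elim/E_ind: e => k x y; rewrite z2E_pt => xy.
have [h0 h1 h2 h3] := crd_vec4 z1 w x y.
have := @has_coords_Mpt k (vec4 z1 w x y); rewrite h0 h1 h2 h3 => /(_ erefl w0 xy).
by move=> /critical_coords ->; rewrite h2 h3 node_pt.
Qed.

End Fibre.

(** * The lines {w} x C_n as P^1-fibre maps *)

Section StandardCurves.
Variables (R : realType) (eps : R) (z1 : Cx R).
Hypotheses (heps : eps <= 1) (hz : in_polydisk eps (z1, 0)).
Local Notation C := (Cx R).
Local Notation Psi := (Psi0 R).
Local Notation M := (M Psi eps).
Local Notation b := ((z1, 0) : C * C).
Local Notation Mpt := (Mpt hz).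
Implicit Types (g h : int * int) (w c d : C).

Definition line_pt w (n : int) (s : P1 R) : M := Mpt w (chain_pt n s).

Lemma is_derive_affine (c d s : C) : is_derive s 1 (fun t : C => c * t + d) c.
Proof.
have := derive_quadratic 0 c d s.
rewrite mulr0 mul0r add0r.
by under eq_fun => t do rewrite mul0r add0r.
Qed.

(** With d = 0 this is an x-axis and with c = 0 a y-axis, so both affine charts of a line are
    treated together. *)
Definition lin_lift w (c d : C) (t : C) : 'rV[C]_4 := vec4 z1 w (c * t) (d * t).

Lemma is_derive_lin_lift w c d (s : C) i :
  is_derive s 1 (fun t => lin_lift w c d t 0 i) (vec4 0 0 c d 0 i).
Proof.
under eq_fun => t do rewrite mxE.
rewrite mxE; case: i => -[|[|[|[|//]]]] _ /=; try exact: is_derive_cst.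
  by have := is_derive_affine c 0 s; under eq_fun => t do rewrite addr0.
by have := is_derive_affine d 0 s; under eq_fun => t do rewrite addr0.
Qed.

Lemma derivable_lin_lift w c d s i : derivable (fun t => lin_lift w c d t 0 i) s 1.
Proof. by have := is_derive_lin_lift w c d s i; case. Qed.

Lemma velocity_lin_lift w c d s : velocity (lin_lift w c d) s = vec4 0 0 c d.
Proof.
apply/rowP => i; rewrite mxE.
exact: (@derive_val _ _ _ _ _ _ _ (is_derive_lin_lift w c d s i)).
Qed.

Lemma crd_lin_lift w c d t :
  [/\ crd (lin_lift w c d t) 0 = z1, crd (lin_lift w c d t) 1 = w,
      crd (lin_lift w c d t) 2 = c * t & crd (lin_lift w c d t) 3 = d * t].
Proof. exact: crd_vec4. Qed.

Lemma lin_lift_coords w k c d t : w != 0 -> c * d = 0 ->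
  has_coords k (lin_lift w c d t) (Mpt w (Ept k (c * t) (d * t))).
Proof.
move=> w0 cd; have [h0 h1 h2 h3] := crd_lin_lift w c d t.
have := @has_coords_Mpt _ _ _ hz k (lin_lift w c d t); rewrite h0 h1 h2 h3; apply => //.
by rewrite mulrACA cd mul0r.
Qed.

Lemma line_ptE_infty w n (t : C) : line_pt w n (P1_infty t) = Mpt w (Ept (n + 1) 0 t).
Proof.
rewrite /line_pt /P1_infty; have [->//|t0] := eqVneq t 0.
by rewrite Ept_yaxis // addrK.
Qed.

Lemma line_lifts_zero w n (c s : C) : w != 0 ->
  lifts_near (fun t : C => line_pt w n (Some (c * t))) s n (lin_lift w c 0).
Proof.
move=> w0; apply: nearCW => t; split; last by move=> i; exact: derivable_lin_lift.
by have := @lin_lift_coords w n c 0 t w0; rewrite mul0r mulr0; apply.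
Qed.

Lemma line_lifts_infty w n (s : C) : w != 0 ->
  lifts_near (line_pt w n \o @P1_infty R) s (n + 1) (lin_lift w 0 1).
Proof.
move=> w0; apply: nearCW => t; split; last by move=> i; exact: derivable_lin_lift.
rewrite /= line_ptE_infty.
by have := @lin_lift_coords w (n + 1) 0 1 t w0; rewrite !mul0r mul1r; apply.
Qed.

(** The Hamiltonian field of xy is x d/dx - y d/dy, which on an axis is t or -t times the
    velocity. *)
Lemma hamiltonian_lin_lift w c d t : c * d = 0 ->
  hamiltonian_z2 (lin_lift w c d t)
    ((t * (if d == 0 then 1 else -1)) *: velocity (lin_lift w c d) t).
Proof.
move=> cd a; rewrite velocity_lin_lift /omega /dz2.
have [h0 h1 h2 h3] := crd_lin_lift w c d t.
have [v0 v1 v2 v3] := crd_vec4 0 0 c d.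
have Z x n : crd (x *: vec4 0 0 c d) n = x * crd (vec4 0 0 c d) n by rewrite /crd mxE.
rewrite !Z h1 h2 h3 v0 v1 v2 v3 !(mulr0, mul0r) subrr mul0r add0r.
have [d0|d0] := eqVneq d 0; first by rewrite d0; ring.
have -> : c = 0 by apply/eqP; move/eqP: cd; rewrite mulf_eq0 (negbTE d0) orbF.
ring.
Qed.

Lemma line_pt_critical w n s : w != 0 ->
  critical (line_pt w n s) <-> s = Some 0 \/ s = None.
Proof. by move=> w0; rewrite critical_Mpt ?z2E_chain // node_chain. Qed.

Lemma line_pt_eq w n s w' n' s' : w != 0 -> w' != 0 ->
  line_pt w n s = line_pt w' n' s' <-> exists g, w' = qmul z1 g * w /\
    chain_pt n' s' = chain_pt (n + g.2) (scaleP1 (rmul z1 g)^-1 s).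
Proof.
move=> w0 w0'; rewrite Mpt_eq ?z2E_chain //.
by split=> -[g [hw he]]; exists g; split => //; move: he; rewrite act_chain ?rmul_neq0.
Qed.

(** Away from the nodes, equality in the chain forces the identifying element to have shift m = 0;
    fixing w as well, it is trivial by [qmul_inj]. *)
Lemma line_pt_inj w n s t : w != 0 -> ~ critical (line_pt w n s) ->
  line_pt w n s = line_pt w n t -> s = t.
Proof.
move=> w0; rewrite line_pt_critical // => ncrit /line_pt_eq[//|//|[j m] [qg]].
move=> /chain_ptP H.
have {H} [nE sE] : n = n + m /\ t = scaleP1 (rmul z1 (j, m))^-1 s.
  case: H => [//|[_ _ sE]|[_ _ sE]]; case: ncrit; case: s sE => //=; last by right.
  move=> x [/eqP]; rewrite mulf_eq0 invr_eq0 (negbTE (rmul_neq0 _ _)) => /eqP ->.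
  by left.
have m0 : m = 0 by apply/(addrI n); rewrite addr0.
have q1 : qmul z1 (j, 0) = 1.
  by apply: (mulIf w0); rewrite mul1r -m0 -qg.
have j0 := qmul_inj heps hz q1.
by rewrite sE m0 j0 rmul0 invr1 scaleP11.
Qed.

Lemma line_fiber_map w n : w != 0 -> P1_fiber_map b (line_pt w n).
Proof.
move=> w0; split.
- by move=> s; rewrite fibr_Mpt // z2E_chain.
- split=> s.
    exists n, (lin_lift w 1 0); split.
      have := line_lifts_zero n 1 s w0.
      by rewrite /comp /P1_zero; under eq_fun => t do rewrite mul1r.
    apply: nearCW => t ncrit; exists (t * (if (0 : C) == 0 then 1 else -1)).
      rewrite eqxx mulr1; apply/eqP => t0; apply: ncrit.
      by rewrite /= /P1_zero t0 line_pt_critical //; left.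
    by apply: hamiltonian_lin_lift; rewrite mulr0.
  exists (n + 1), (lin_lift w 0 1); split; first exact: line_lifts_infty.
  apply: nearCW => t ncrit; exists (t * (if (1 : C) == 0 then 1 else -1)).
    rewrite oner_eq0 mulrN1 oppr_eq0; apply/eqP => t0; apply: ncrit.
    by rewrite /= /P1_infty t0 eqxx line_pt_critical //; right.
  by apply: hamiltonian_lin_lift; rewrite mul0r.
- apply: (@sub_finite_set _ _ [set Some 0; None]); last first.
    by rewrite finite_setU; split; exact: finite_set1.
  by move=> s /=; rewrite line_pt_critical.
- by move=> s t; exact: line_pt_inj.
Qed.

End StandardCurves.

(** * Rational curves in the fibre *)

Section LocalStructure.
Variables (R : realType) (eps : R) (z1 : Cx R).
Hypotheses (heps : eps <= 1) (hz : in_polydisk eps (z1, 0)).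
Local Notation C := (Cx R).
Local Notation M := (M (Psi0 R) eps).
Local Notation b := ((z1, 0) : C * C).
Local Notation Mpt := (Mpt hz).
Local Notation line_pt := (line_pt hz).
Implicit Types (w : C) (k n : int).

Lemma nearC_and (s : C) (P Q : C -> Prop) :
  (\forall t \near s, P t) -> (\forall t \near s, Q t) -> \forall t \near s, P t /\ Q t.
Proof.
move=> /nearCP[d d0 hd] /nearCP[d' d'0 hd']; apply/nearCP.
exists (Num.min d d'); first by rewrite lt_min d0.
by move=> t; rewrite lt_min => /andP[/hd ? /hd'].
Qed.

Lemma nearC_mono (s : C) (P Q : C -> Prop) : (forall t, P t -> Q t) ->
  (\forall t \near s, P t) -> \forall t \near s, Q t.
Proof. by move=> PQ /nearCP[d d0 hd]; apply/nearCP; exists d => // t /hd/PQ. Qed.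

Lemma nearC_self (s : C) (P : C -> Prop) : (\forall t \near s, P t) -> P s.
Proof. by move=> /nearCP[d d0]; apply; rewrite subrr cmod0. Qed.

Lemma nearC_punctured (s : C) (P : C -> Prop) : (\forall t \near s, P t) ->
  exists2 t, t != s & P t.
Proof.
move=> /nearCP[d d0 hd]; exists (s + ofR (d / 2)).
  by rewrite -subr_eq0 addrC addKr ofR_eq0 gt_eqF // divr_gt0.
apply: hd; rewrite addrC addKr cmod_ofR ger0_norm ?divr_ge0 ?ltW //.
by rewrite ltr_pdivrMr // ltr_pMr // ltr1n.
Qed.

Lemma near_derivable_neq0 (f : C -> C) s : derivable f s 1 -> f s != 0 ->
  \forall t \near s, f t != 0.
Proof.
move=> /derivable_cont_at fc fs0.
have [|d d0 hd] := fc (cmod (f s)); first by rewrite cmod_gt0.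
apply/nearCP; exists d => // t /hd h; apply/eqP => ft0.
by move: h; rewrite ft0 sub0r cmodN ltxx.
Qed.

Lemma hamiltonian_coords (v h : 'rV[C]_4) (c : C) : crd v 1 != 0 ->
  hamiltonian_z2 v (c *: h) ->
  [/\ c * crd h 1 = 0, c * crd h 2 = crd v 2 & - (c * crd h 3) = crd v 3].
Proof.
move=> w0 H.
have Z (n : nat) : crd (c *: h) n = c * crd h n by rewrite /crd mxE.
have := H (vec4 1 0 0 0); have := H (vec4 0 0 1 0); have := H (vec4 0 0 0 1).
rewrite /omega /dz2 !Z.
have [-> -> -> ->] := crd_vec4 (0 : C) 0 0 1.
have [-> -> -> ->] := crd_vec4 (0 : C) 0 1 0.
have [-> -> -> ->] := crd_vec4 (1 : C) 0 0 0.
move: w0; move: (crd v 1) (crd v 2) (crd v 3) (crd h 0) (crd h 1) (crd h 2) (crd h 3).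
move=> w x y h0 h1 h2 h3 w0.
rewrite !(mulr0, mulr1, subr0, sub0r, add0r, addr0, mul0r, oppr0) => H3 H2 H1.
split=> //; move/eqP: H1.
by rewrite mulf_eq0 invr_eq0 (negbTE w0) orbF oppr_eq0 => /eqP.
Qed.

(** The Hamiltonian field has no w-component, so w has derivative 0 off s0 and is constant near s0
    by [near_constant], even when s0 is critical. Its other components show that a nonzero
    coordinate has nonzero derivative. *)
Lemma local_lift (g : C -> M) s0 : (forall s, fibr (g s) = b) ->
  hol_tangent_at g s0 -> (\forall s \near s0, s != s0 -> ~ critical (g s)) ->
  exists w k X Y, w != 0 /\ \forall s \near s0,
   [/\ g s = Mpt w (Ept k (X s) (Y s)), X s * Y s = 0,
       derivable X s 1, derivable Y s 1 &
       ~ critical (g s) -> (X s != 0 -> 'D_1 X s != 0) /\ (Y s != 0 -> 'D_1 Y s != 0)].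
Proof.
move=> gb [k [phi [hlift htan]]] hcrit.
pose comp (n : nat) (t : C) : C := phi t 0 (inord n).
have vE (n : nat) s : crd (velocity phi s) n = 'D_1 (comp n) s by rewrite /crd mxE.
have tangent s : crd (phi s) 1 != 0 ->
    (exists2 c : C, c != 0 & hamiltonian_z2 (phi s) (c *: velocity phi s)) ->
    [/\ 'D_1 (comp 1) s = 0, (comp 2 s != 0 -> 'D_1 (comp 2) s != 0) &
        (comp 3 s != 0 -> 'D_1 (comp 3) s != 0)].
  move=> w0 [c c0 H].
  have [H1 H2 H3] := hamiltonian_coords w0 H; rewrite !vE in H1 H2 H3.
  split.
  - by move/eqP: H1; rewrite mulf_eq0 (negbTE c0) => /eqP.
  - by apply: contraNneq => D0; rewrite -[comp 2 s]/(crd (phi s) 2) -H2 D0 mulr0.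
  - by apply: contraNneq => D0; rewrite -[comp 3 s]/(crd (phi s) 3) -H3 D0 mulr0 oppr0.
have coords : \forall s \near s0,
   [/\ crd (phi s) 1 != 0, crd (phi s) 2 * crd (phi s) 3 = 0,
       g s = Mpt (crd (phi s) 1) (Ept k (crd (phi s) 2) (crd (phi s) 3)) &
       forall n : nat, derivable (comp n) s 1].
  apply: nearC_mono hlift => s [/has_coords_fibr H D].
  have [_ h1 h2 h3] := H _ hz (gb s); split => // n; exact: D.
have W0 : \forall s \near s0, comp 1 s = comp 1 s0.
  apply: near_constant.
  apply: nearC_mono (nearC_and coords (nearC_and htan hcrit)) => s.
  move=> [[w0 _ _ D] [ht hc]]; split; first exact: D.
  by move=> /hc/ht/(tangent _ w0)[].
exists (comp 1 s0), k, (comp 2), (comp 3); split.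
  by have [] := nearC_self coords.
apply: nearC_mono (nearC_and coords (nearC_and htan W0)) => s.
move=> [[w0 xy gE D] [ht <-]]; split => //.
by move=> /ht/(tangent _ w0)[].
Qed.

(** At a noncritical point exactly one of x_k, y_k is nonzero. If it is y_k, the point lies on
    C_(k-1) with coordinate 1 / y_k. *)
Lemma local_line (g : C -> M) s0 : (forall s, fibr (g s) = b) ->
  hol_tangent_at g s0 -> (\forall s \near s0, s != s0 -> ~ critical (g s)) ->
  ~ critical (g s0) ->
  exists w n X, w != 0 /\ \forall s \near s0,
   [/\ g s = line_pt w n (Some (X s)), X s != 0, derivable X s 1 & 'D_1 X s != 0].
Proof.
move=> gb ht hc ncrit; have [w [k [X [Y [w0 H]]]]] := local_lift gb ht hc.
have hnc : \forall s \near s0, ~ critical (g s).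
  by apply: nearC_mono hc => s hs; have [->|/hs] := eqVneq s s0.
have [gE xy DX DY _] := nearC_self H.
have [X0|X0] := eqVneq (X s0) 0; last first.
  exists w, k, X; split => //.
  apply: nearC_mono (nearC_and hnc (nearC_and H (near_derivable_neq0 DX X0))) => s.
  move=> [nc [[gsE xys DXs _ tan] Xs0]]; split => //; last by have [/(_ Xs0)] := tan nc.
  have -> : line_pt w k (Some (X s)) = Mpt w (Ept k (X s) 0) by [].
  rewrite gsE; suff -> : Y s = 0 by [].
  by apply/eqP; move/eqP: xys; rewrite mulf_eq0 (negbTE Xs0).
have Y0 : Y s0 != 0.
  apply/eqP => Y0; apply: ncrit; rewrite gE X0 Y0 critical_Mpt ?z2E_pt ?mulr0 //.
  by exists k.
exists w, (k - 1), (fun s => (Y s)^-1); split => //.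
apply: nearC_mono (nearC_and hnc (nearC_and H (near_derivable_neq0 DY Y0))) => s.
move=> [nc [[gsE xys _ DYs tan] Ys0]].
have Xs0 : X s = 0.
  by apply/eqP; move/eqP: xys; rewrite mulf_eq0 (negbTE Ys0) orbF.
split.
- by rewrite gsE Xs0 Ept_yaxis.
- by rewrite invr_eq0.
- exact: derivableV.
- rewrite deriveV // /GRing.scale /=.
  have [_ /(_ Ys0) D0] := tan nc.
  by rewrite mulf_neq0 // oppr_eq0 invr_eq0 expf_neq0.
Qed.

Definition same_line w k w0 n0 : Prop := exists g, w0 = qmul z1 g * w /\ n0 = k + g.2.

(** Whether a non-nodal point of one line lies on another does not depend on the point; this makes
    membership in a line locally constant along u. *)
Lemma same_lineP w k w0 n0 (x : C) : w != 0 -> w0 != 0 -> x != 0 ->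
  (exists2 x0 : C, x0 != 0 & line_pt w k (Some x) = line_pt w0 n0 (Some x0)) <->
  same_line w k w0 n0.
Proof.
move=> hw hw0 hx; split.
  move=> [x0 hx0 /line_pt_eq[//|//|g [-> /chain_ptP[[-> _]|[_ //]|[_ []]]]]].
    by exists g.
  by move=> /eqP; rewrite (negbTE hx0).
move=> [g [qg nE]]; exists ((rmul z1 g)^-1 * x).
  by rewrite mulf_neq0 // invr_eq0 rmul_neq0.
by apply/line_pt_eq => //; exists g; split=> //; rewrite -nE.
Qed.

Lemma same_line_scale w k w0 n0 : w != 0 -> w0 != 0 -> same_line w k w0 n0 ->
  exists2 c : C, c != 0 & forall s, line_pt w k s = line_pt w0 n0 (scaleP1 c s).
Proof.
move=> hw hw0 [g [qg nE]]; exists (rmul z1 g)^-1; first by rewrite invr_eq0 rmul_neq0.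
by move=> s; apply/line_pt_eq => //; exists g; split=> //; rewrite -nE.
Qed.

End LocalStructure.

(** * Every P^1-fibre map covers exactly one line *)

Section Classification.
Variables (R : realType) (eps : R) (z1 : Cx R).
Hypotheses (heps : eps <= 1) (hz : in_polydisk eps (z1, 0)).
Local Notation C := (Cx R).
Local Notation P1 := (P1 R).
Local Notation M := (M (Psi0 R) eps).
Local Notation b := ((z1, 0) : C * C).
Local Notation Mpt := (Mpt hz).
Local Notation line_pt := (line_pt hz).
Variable u : P1 -> M.
Hypothesis hu : P1_fiber_map b u.

Let crit p := critical (u p).

Definition is_chart (c : C -> P1) := injective c /\ forall s, hol_tangent_at (u \o c) s.

Lemma chart_zero : is_chart (@P1_zero R).
Proof. by have [_ [h _] _ _] := hu; split => // s t []. Qed.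

Lemma chart_infty : is_chart (@P1_infty R).
Proof.
have [_ [_ h] _ _] := hu; split => // s t; rewrite /P1_infty.
by have [->|s0] := eqVneq s 0; have [->|t0] := eqVneq t 0 => // -[/invr_inj].
Qed.

Lemma chart_cover p : exists c s, is_chart c /\ p = c s.
Proof.
case: p => [s|]; first by exists (@P1_zero R), s; split=> //; exact: chart_zero.
exists (@P1_infty R), 0; split; first exact: chart_infty.
by rewrite /P1_infty eqxx.
Qed.

Lemma chart_fibr (c : C -> P1) (s : C) : fibr ((u \o c) s) = b.
Proof. by have [-> _ _ _] := hu. Qed.

Lemma near_finite (S : set C) (s0 : C) : finite_set S ->
  \forall s \near s0, s != s0 -> ~ S s.
Proof.
move=> Sfin; have [d d0 hd] : exists2 d : R, 0 < d &
    forall s, S s -> s != s0 -> d <= cmod (s - s0).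
  have /finite_seqP[l ->] := Sfin.
  elim: l => [|a l [d d0 IH]]; first by exists 1.
  have [as0|as0] := eqVneq a s0.
    exists d => // s; rewrite /= inE => /orP[/eqP ->|]; first by rewrite as0 eqxx.
    exact: IH.
  exists (Num.min d (cmod (a - s0))).
    by rewrite lt_min d0 cmod_gt0 subr_eq0.
  move=> s; rewrite /= inE ge_min => /orP[/eqP -> _|sl ss0]; first by rewrite lexx orbT.
  by rewrite IH.
apply/nearCP; exists d => // s hs ss0 /hd/(_ ss0).
by rewrite leNgt hs.
Qed.

Lemma near_noncrit c s0 : is_chart c ->
  \forall s \near s0, s != s0 -> ~ crit (c s).
Proof.
move=> [cinj _]; apply: (near_finite (S := [set s | crit (c s)])).
have [_ _ Sfin _] := hu.
by apply: finite_preimage Sfin => x y _ _; exact: cinj.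
Qed.

Lemma chart_line c s0 : is_chart c -> ~ crit (c s0) ->
  exists w n X, w != 0 /\ \forall s \near s0,
   [/\ u (c s) = line_pt w n (Some (X s)), X s != 0, derivable X s 1 & 'D_1 X s != 0].
Proof.
move=> hc; apply: local_line => //; [exact: chart_fibr | by case: hc | exact: near_noncrit].
Qed.

(** Nodes are left out, since they also lie on the neighbouring lines. *)
Definition on_line w0 n0 (m : M) := exists2 x : C, x != 0 & m = line_pt w0 n0 (Some x).

Lemma noncritical_single_line : exists w0 n0, w0 != 0 /\
  forall p, ~ crit p -> on_line w0 n0 (u p).
Proof.
have [_ _ Sfin _] := hu.
have S0fin : finite_set [set s : C | crit (Some s)].
  by apply: finite_preimage Sfin => x y _ _ [].
have natr_inj : injective (fun n : nat => n%:R : C).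
  by move=> n n' /eqP; rewrite eqr_nat => /eqP.
have [m0] := finite_avoid natr_inj S0fin; move: (m0%:R : C) => p0 hp0.
have [w0 [n0 [X [w00 H]]]] := chart_line chart_zero hp0.
exists w0, n0; split => //.
have A0 : on_line w0 n0 (u (Some p0)).
  by have [E X0 _ _] := nearC_self H; exists (X p0).
have loc c s0 : is_chart c -> ~ crit (c s0) ->
    \forall s \near s0, on_line w0 n0 (u (c s)) <-> on_line w0 n0 (u (c s0)).
  move=> hc /(chart_line hc)[w [n [Y [w0' HY]]]].
  have E (s : C) : [/\ u (c s) = line_pt w n (Some (Y s)), Y s != 0,
      derivable Y s 1 & 'D_1 Y s != 0] ->
      on_line w0 n0 (u (c s)) <-> same_line z1 w n w0 n0.
    by move=> [-> Y0 _ _]; exact: same_lineP.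
  have Es0 := E _ (nearC_self HY).
  by apply: nearC_mono HY => s /E ->; rewrite Es0.
have fin_case s : ~ crit (Some s) -> on_line w0 n0 (u (Some s)).
  move=> hs; pose A (t : C) := on_line w0 n0 (u (Some t)).
  suff locA t : ~ crit (Some t) -> \forall t' \near t, A t' <-> A t.
    exact: (@locally_constant_cofinite R _ A S0fin locA p0 s hp0 hs A0).
  move=> ht.
  exact: (loc (@P1_zero R)) chart_zero ht.
case=> [s|hN]; first exact: fin_case.
(* A noncritical point at infinity is compared with a nearby finite noncritical point, through the
   chart at infinity. *)
have cN : @P1_infty R 0 = None by rewrite /P1_infty eqxx.
have := loc _ 0 chart_infty; rewrite cN => /(_ hN) HN.
have [t t0 [ht nt]] := nearC_punctured (nearC_and HN (near_noncrit 0 chart_infty)).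
apply/ht; have ntc := nt t0; move: ntc; rewrite /P1_infty (negbTE t0).
exact: fin_case.
Qed.

Lemma min_lipschitz (x y k : R) : `|Num.min x k - Num.min y k| <= `|x - y|.
Proof.
wlog xy : x y / x <= y => [H|].
  have /orP[xy|yx] := le_total x y; first exact: H.
  by rewrite [leLHS]distrC [leRHS]distrC; exact: H.
rewrite [leLHS]distrC [leRHS]distrC !ger0_norm ?subr_ge0 //; last first.
  by rewrite le_min !ge_min xy lexx orbT.
by rewrite /Num.min; case: ifP => h1; case: ifP => h2; lra.
Qed.

Lemma cmod_lipschitz (x y : C) : `|cmod x - cmod y| <= cmod (x - y).
Proof.
have h1 := cmod_sub x y; have h2 := cmod_sub y x; rewrite cmodB in h2.
by rewrite ler_norml h1 andbT lerNl opprB.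
Qed.

Section Coordinate.
Variables (w0 : C) (n0 : int).
Hypotheses (w00 : w0 != 0) (on_l : forall p, ~ crit p -> on_line w0 n0 (u p)).

Definition lcoord (p : P1) : C :=
  xget 0 [set x : C | x != 0 /\ u p = line_pt w0 n0 (Some x)].

Lemma lcoordP p : ~ crit p -> lcoord p != 0 /\ u p = line_pt w0 n0 (Some (lcoord p)).
Proof.
move=> /on_l[x x0 hx]; rewrite /lcoord.
by case: xgetP => [y -> //|/(_ x)[]].
Qed.

Lemma lcoord_eq p (x : C) : x != 0 -> u p = line_pt w0 n0 (Some x) -> lcoord p = x.
Proof.
move=> x0 hp.
have ncrit (y : C) : y != 0 -> ~ critical (line_pt w0 n0 (Some y)).
  by move=> y0; rewrite line_pt_critical // => -[[/eqP]|//]; rewrite (negbTE y0).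
have [y0 hy] : lcoord p != 0 /\ u p = line_pt w0 n0 (Some (lcoord p)).
  by apply: lcoordP; rewrite /crit hp; exact: ncrit.
by move: hy; rewrite hp => /(line_pt_inj heps w00 (ncrit _ x0))[].
Qed.

Lemma lcoord_noncrit c s0 : is_chart c -> ~ crit (c s0) ->
  exists f : C -> C, \forall s \near s0,
    [/\ ~ crit (c s), lcoord (c s) = f s, derivable f s 1 & 'D_1 f s != 0].
Proof.
move=> hc ncrit; have [w [n [X [w0' H]]]] := chart_line hc ncrit.
have hnc : \forall s \near s0, ~ crit (c s).
  by apply: nearC_mono (near_noncrit s0 hc) => s hs; have [->|/hs] := eqVneq s s0.
have sl : same_line z1 w n w0 n0.
  have [E X0 _ _] := nearC_self H; apply/(same_lineP hz n n0 w0' w00 X0).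
  by have [x x0 hx] := on_l ncrit; exists x; rewrite // -hx.
have [l l0 hl] := same_line_scale hz w0' w00 sl.
exists (fun s => l * X s).
apply: nearC_mono (nearC_and hnc H) => s [nc [E X0 DX D0]].
have DlX : is_derive s 1 (fun t => l * X t) (l * 'D_1 X s).
  by have := is_deriveZ l (DeriveDef DX erefl).
have lX0 : l * X s != 0 by rewrite mulf_neq0.
split.
- exact: nc.
- by apply: lcoord_eq lX0 _; rewrite E hl.
- by case: DlX.
- rewrite (@derive_val _ _ _ _ _ _ _ DlX); exact: mulf_neq0.
Qed.

Local Notation node0 := (line_pt w0 n0 (Some 0)).
Local Notation nodeoo := (line_pt w0 n0 None).

(** The lift passes through a node at s0, so X and Y tend to 0. Nearby points lie on C_k with
    coordinate X or on C_(k-1) with coordinate 1/Y; up to a constant factor the line coordinate is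
    then small or large. The alternative is chosen for each s, as the two nodes may coincide in
    [M]. *)
Lemma lcoord_crit c s0 (e : R) : is_chart c -> crit (c s0) -> 0 < e ->
  \forall s \near s0, s != s0 -> ~ crit (c s) /\
    (u (c s0) = node0 /\ cmod (lcoord (c s)) < e \/
     u (c s0) = nodeoo /\ e^-1 < cmod (lcoord (c s))).
Proof.
move=> hc hcrit e0.
have [w [k [X [Y [w0' H]]]]] := local_lift hz (chart_fibr c) (hc.2 s0) (near_noncrit s0 hc).
have [E0 XY0 DX DY _] := nearC_self H.
have [X0 Y0] : X s0 = 0 /\ Y s0 = 0.
  apply/(node_pt k); apply/(critical_Mpt hz w0'); rewrite ?z2E_pt //.
  by rewrite -E0.
have small (f : C -> C) (l : C) : derivable f s0 1 -> f s0 = 0 -> l != 0 ->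
    \forall s \near s0, cmod (l * f s) < e.
  move=> Df f0 l0; have [|d d0 hd] := derivable_cont_at Df (e := e / cmod l).
    by rewrite divr_gt0 // cmod_gt0.
  apply/nearCP; exists d => // s /hd; rewrite f0 subr0 ltr_pdivlMr ?cmod_gt0 //.
  by rewrite mulrC cmodM.
(* If C_k is not the given line, no noncritical nearby point can lie on the x-axis and the claim is
   vacuous. *)
have brX : \forall s \near s0, X s != 0 -> ~ crit (c s) -> u (c s) = Mpt w (Ept k (X s) 0) ->
    u (c s0) = node0 /\ cmod (lcoord (c s)) < e.
  have [sl|nsl] := pselect (same_line z1 w k w0 n0); last first.
    apply: nearCW => s Xs0 nc uE; case: nsl; apply/(same_lineP hz k n0 w0' w00 Xs0).
    by have [x x0 hx] := on_l nc; exists x; rewrite // -hx uE.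
  have [l l0 hl] := same_line_scale hz w0' w00 sl.
  apply: nearC_mono (small X l DX X0 l0) => s hs Xs0 nc uE; split.
    have -> : node0 = line_pt w0 n0 (scaleP1 l (Some 0)) by rewrite /= mulr0.
    by rewrite -hl /line_pt /=; move: E0 => /= ->; rewrite X0 Y0.
  suff -> : lcoord (c s) = l * X s by [].
  by apply: lcoord_eq; [rewrite mulf_neq0 | rewrite uE; exact: (hl (Some (X s)))].
have brY : \forall s \near s0, Y s != 0 -> ~ crit (c s) -> u (c s) = Mpt w (Ept k 0 (Y s)) ->
    u (c s0) = nodeoo /\ e^-1 < cmod (lcoord (c s)).
  have [sl|nsl] := pselect (same_line z1 w (k - 1) w0 n0); last first.
    apply: nearCW => s Ys0 nc uE; case: nsl.
    have Yi0 : (Y s)^-1 != 0 by rewrite invr_eq0.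
    apply/(same_lineP hz (k - 1) n0 w0' w00 Yi0).
    by have [x x0 hx] := on_l nc; exists x; rewrite // -hx uE Ept_yaxis.
  have [l l0 hl] := same_line_scale hz w0' w00 sl.
  have li0 : l^-1 != 0 by rewrite invr_eq0.
  apply: nearC_mono (small Y l^-1 DY Y0 li0) => s hs Ys0 nc uE; split.
    have -> : nodeoo = line_pt w0 n0 (scaleP1 l None) by [].
    by rewrite -hl /line_pt /= subrK; move: E0 => /= ->; rewrite X0 Y0.
  have -> : lcoord (c s) = l / Y s.
    apply: lcoord_eq; first by rewrite mulf_neq0 // invr_eq0.
    by rewrite uE Ept_yaxis //; exact: (hl (Some (Y s)^-1)).
  have -> : l / Y s = (l^-1 * Y s)^-1 by rewrite invfM invrK.
  by rewrite cmodV ltf_pV2 // posrE cmod_gt0 mulf_neq0.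
apply: nearC_mono (nearC_and (near_noncrit s0 hc) (nearC_and H (nearC_and brX brY))).
move=> s [nc [[uE XYs _ _ _] [hX hY]]] ss0; have ncs := nc ss0; split => //.
have [Xs0|Xs0] := eqVneq (X s) 0.
  right; apply: hY => //; last by rewrite -Xs0.
  apply: contra_not_neq ncs => Ys0; rewrite /crit; move: uE => /= ->.
  by rewrite Xs0 Ys0 critical_Mpt ?z2E_pt ?mulr0 //; exists k.
left; apply: hX => //; move: uE => /= ->; suff -> : Y s = 0 by [].
by apply/eqP; move/eqP: XYs; rewrite mulf_eq0 (negbTE Xs0).
Qed.

(* A function of the coordinate, extended by K at the critical points, attains *)
(* its minimum on P^1.                                                         *)
Lemma lcoord_min (phi : C -> R) (K : R) :
  (forall x y, `|phi x - phi y| <= cmod (x - y)) ->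
  (forall e, 0 < e -> exists2 e', 0 < e' & forall p, crit p -> forall x : C,
    (u p = node0 /\ cmod x < e') \/ (u p = nodeoo /\ e'^-1 < cmod x) ->
    `|phi x - K| < e) ->
  let H p := if `[< crit p >] then K else phi (lcoord p) in
  exists p, forall q, H p <= H q.
Proof.
move=> phiL phiK H.
have Hc c : is_chart c -> forall s e, 0 < e -> \forall t \near s, `|H (c t) - H (c s)| < e.
  move=> hc s e e0.
  have [cs|ncs] := pselect (crit (c s)).
    have [e' e'0 he'] := phiK _ e0.
    apply: nearC_mono (lcoord_crit hc cs e'0) => t ht.
    have [->|/ht[nct h]] := eqVneq t s; first by rewrite subrr normr0.
    rewrite /H (asboolT cs) (asboolF nct); exact: he' cs _ h.
  have [f hf] := lcoord_noncrit hc ncs.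
  have [_ fs Df _] := nearC_self hf.
  apply: nearC_mono (nearC_and hf (derivable_cont Df e0)) => t [[nct ft _ _] he].
  rewrite /H (asboolF ncs) (asboolF nct) ft fs.
  exact: le_lt_trans (phiL _ _) he.
by apply: P1_min; apply: Hc; [exact: chart_zero | exact: chart_infty].
Qed.

(** min(|x - v|, |v|) extends by |v| to the critical points, where x tends to 0 or infinity. A value
    below |v| puts the minimum at a noncritical point, where x = v; [disc_chain] propagates from one
    value to all. *)
Lemma lcoord_onto (v : C) : v != 0 -> exists2 p, ~ crit p & lcoord p = v.
Proof.
move: v.
have [p0 np0] : exists p, ~ crit p.
  have [_ _ Sfin _] := hu.
  have Some_inj : injective (fun n : nat => Some (n%:R : C)).
    by move=> n n' [] /eqP; rewrite eqr_nat => /eqP.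
  by have [n hn] := finite_avoid (T := P1) Some_inj Sfin; exists (Some n%:R).
apply: (disc_chain (x0 := lcoord p0)); [by have [] := lcoordP np0 | by exists p0 |].
move=> _ v [p1 np1 <-] x0 v0 hlt.
pose phi x := Num.min (cmod (x - v)) (cmod v).
have [||p hp] := lcoord_min (phi := phi) (K := cmod v).
- move=> x y; apply: le_trans (min_lipschitz _ _ _) _.
  apply: le_trans (cmod_lipschitz _ _) _.
  by have -> : x - v - (y - v) = x - y by ring.
- move=> e e0; have v20 : 0 < 2 * cmod v by rewrite mulr_gt0 ?cmod_gt0.
  (* The second bound makes a large x satisfy |x| > 2 |v|, so that |x - v| > |v|. *)
  exists (Num.min e (2 * cmod v)^-1); first by rewrite lt_min e0 invr_gt0.
  move=> p cp x [[_]|[_]].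
    rewrite lt_min => /andP[xe _].
    rewrite /phi -{2}[cmod v](minxx (cmod v)).
    apply: le_lt_trans (min_lipschitz _ _ _) _; rewrite -[cmod v]cmodN.
    apply: le_lt_trans (cmod_lipschitz _ _) _.
    by have -> : x - v - - v = x by ring.
  have M0 : 0 < Num.min e (2 * cmod v)^-1 by rewrite lt_min e0 invr_gt0.
  have : 2 * cmod v <= (Num.min e (2 * cmod v)^-1)^-1.
    by rewrite -[leLHS]invrK lef_pV2 ?posrE ?invr_gt0 // ge_min lexx orbT.
  move=> /le_lt_trans h /h hx; rewrite /phi (min_idPr _) ?subrr ?normr0 //.
  by have := cmod_sub x v; lra.
have H1 := hp p1; rewrite (asboolF np1) in H1.
have Hlt : phi (lcoord p1) < cmod v by rewrite /phi gt_min hlt.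
have np : ~ crit p.
  by move=> cp; move: H1; rewrite (asboolT cp) leNgt Hlt.
exists p => //; apply: contrapT => /eqP pv.
have [c [s [hc pE]]] := chart_cover p; subst p.
have [f hf] := lcoord_noncrit hc np.
have [_ fs Df D0] := nearC_self hf.
apply: (derivable_not_local_min Df D0 (v := v)); first by rewrite -fs.
apply: nearC_mono hf => t [nct ft _ _].
have := hp (c t); rewrite (asboolF np) (asboolF nct) -ft -fs => H2.
have H3 : phi (lcoord (c s)) < cmod v.
  by move: H1; rewrite (asboolF np) => H1; exact: le_lt_trans H1 Hlt.
have H4 : phi (lcoord (c s)) = cmod (lcoord (c s) - v).
  by apply/min_idPl; move: H3; rewrite /phi gt_min ltxx orbF => /ltW.
by rewrite -H4; apply: le_trans H2 _; rewrite /phi ge_min lexx.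
Qed.

(** Otherwise min(|x|, 1) would extend by 1 and have a positive minimum d, contradicting the value x
    = d/2. *)
Lemma node0_hit : exists p, u p = node0.
Proof.
apply: contrapT => nohit.
have [||p hp] := lcoord_min (phi := fun x => Num.min (cmod x) 1) (K := 1).
- move=> x y; apply: le_trans (min_lipschitz _ _ _) _; exact: cmod_lipschitz.
- move=> e e0; exists 1 => // p cp x [[up _]|[_]]; first by case: nohit; exists p.
  by rewrite invr1 => /ltW h; rewrite (min_idPr h) subrr normr0.
pose d := (if `[< crit p >] then 1 else Num.min (cmod (lcoord p)) 1) : R.
have d0 : 0 < d.
  rewrite /d; case: asboolP => // /lcoordP[x0 _].
  by rewrite lt_min cmod_gt0 x0 ltr01.
have [|q nq qE] := lcoord_onto (v := ofR (d / 2)).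
  by rewrite ofR_eq0 gt_eqF // divr_gt0.
have hd : d <= Num.min (cmod (lcoord q)) 1 by have := hp q; rewrite (asboolF nq).
move: hd; rewrite qE cmod_ofR ger0_norm; last by rewrite divr_ge0 // ltW.
by rewrite le_min ler_pdivlMr // => /andP[+ _]; rewrite ger_pMr // => h; move: h; lra.
Qed.

(** Otherwise - |x| would extend by 0 and have a minimum d, contradicting the value x = 1 - d. *)
Lemma nodeoo_hit : exists p, u p = nodeoo.
Proof.
apply: contrapT => nohit.
have [||p hp] := lcoord_min (phi := fun x => - cmod x) (K := 0).
- by move=> x y; rewrite -opprD normrN; exact: cmod_lipschitz.
- move=> e e0; exists e => // p cp x [[_ h]|[up _]]; last by case: nohit; exists p.
  by rewrite subr0 normrN ger0_norm // cmod_ge0.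
pose d := (if `[< crit p >] then 0 else - cmod (lcoord p)) : R.
have [|q nq qE] := lcoord_onto (v := ofR (1 - d)).
  rewrite ofR_eq0 gt_eqF // subr_gt0.
  rewrite /d; case: asboolP => // _; by rewrite (@le_lt_trans _ _ 0) // oppr_le0 cmod_ge0.
have : d <= - cmod (lcoord q) by have := hp q; rewrite (asboolF nq).
by rewrite qE cmod_ofR; have := ler_norm (1 - d); lra.
Qed.

Lemma range_line : range u = range (line_pt w0 n0).
Proof.
apply/seteqP; split.
  move=> _ [p _ <-]; have [cp|np] := pselect (crit p); last first.
    by have [_ ->] := lcoordP np; exists (Some (lcoord p)).
  have [c [s [hc pE]]] := chart_cover p; subst p.
  have [t ts /(_ ts)[_ [[-> _]|[-> _]]]] := nearC_punctured (lcoord_crit hc cp ltr01).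
    by exists (Some 0).
  by exists None.
move=> _ [[x|] _ <-]; last by have [p <-] := nodeoo_hit; exists p.
have [->|x0] := eqVneq x 0; first by have [p <-] := node0_hit; exists p.
have [p np pE] := lcoord_onto x0; exists p => //.
by have [_ ->] := lcoordP np; rewrite pE.
Qed.

End Coordinate.

Lemma fiber_map_range : exists w n, w != 0 /\ range u = range (line_pt w n).
Proof.
have [w0 [n0 [w00 H]]] := noncritical_single_line.
by exists w0, n0; split => //; exact: range_line.
Qed.

End Classification.

(** * Characteristic cycles *)

Section Cycles.
Variables (R : realType) (eps : R) (z1 : Cx R).
Hypotheses (heps : eps <= 1) (hz : in_polydisk eps (z1, 0)).
Local Notation C := (Cx R).
Local Notation M := (M (Psi0 R) eps).
Local Notation b := ((z1, 0) : C * C).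
Local Notation line_pt := (line_pt hz).

Definition line w n : set M := range (line_pt w n).
Definition lines w : set (set M) := [set line w n | n in [set: int]].

Lemma same_line_range (w w0 : C) (k n0 : int) : w != 0 -> w0 != 0 ->
  same_line z1 w k w0 n0 -> line w k = line w0 n0.
Proof.
move=> hw hw0 /(same_line_scale hz hw hw0)[c c0 hc].
apply/seteqP; split=> _ [s _ <-]; first by exists (scaleP1 c s).
exists (scaleP1 c^-1 s) => //; rewrite hc; congr (line_pt _ _ _).
by case: s => [x|] //=; rewrite mulrA divff // mul1r.
Qed.

Lemma characteristic_curveP (A : set M) :
  characteristic_curve b A <-> exists w n, w != 0 /\ A = line w n.
Proof.
split; last by move=> [w [n [w0 ->]]]; exists (line_pt w n) => //; exact: line_fiber_map.
by move=> [u hu <-]; exact: (fiber_map_range heps hz hu).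
Qed.

(** A common point makes w' equal to [qmul z1 g * w] for some g, and g carries a line over w onto
    the given line over w'. Thus connected families never leave [lines w], which is therefore
    maximal. *)
Lemma lines_meet (w w' : C) (n n' : int) : w != 0 -> w' != 0 ->
  line w n `&` line w' n' !=set0 -> lines w (line w' n').
Proof.
move=> w0 w0' [_ [[s _ <-] [t _ /esym/line_pt_eq[//|//|g [qg _]]]]].
exists (n' - g.2) => //; apply: same_line_range => //.
by exists g; split => //; rewrite subrK.
Qed.

Lemma curve_family_lines F (w : C) n : w != 0 -> curve_family b F -> F (line w n) ->
  F `<=` lines w.
Proof.
move=> w0 [_ Fc Fconn] FA B FB; have := Fconn _ _ FA FB.
have : lines w (line w n) by exists n.
move: (line w n) => A; move=> + AB; elim: AB => //.
  move=> X Y [FX FY XY] [k _ kX]; move: XY; rewrite -kX.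
  have /Fc/characteristic_curveP[w' [n' [w0' ->]]] := FY.
  exact: lines_meet.
by move=> X Y Z _ IH1 _ IH2 /IH1/IH2.
Qed.

Lemma lines_curve_family (w : C) : w != 0 -> curve_family b (lines w).
Proof.
move=> w0; split; first by exists (line w 0), 0.
  by move=> _ [n _ <-]; apply/characteristic_curveP; exists w, n.
have step n : line w n `&` line w (n + 1) !=set0.
  exists (line_pt w n None); split; first by exists None.
  by exists (Some 0).
have walk (d : nat) n : clos_refl_trans _ (fun X Y => [/\ lines w X, lines w Y & X `&` Y !=set0])
    (line w n) (line w (n + d%:Z)) /\
    clos_refl_trans _ (fun X Y => [/\ lines w X, lines w Y & X `&` Y !=set0])
    (line w (n + d%:Z)) (line w n).
  elim: d => [|d [IH1 IH2]]; first by rewrite addr0; split; exact: rt_refl.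
  have -> : n + d.+1%:Z = n + d%:Z + 1 by rewrite -addrA; congr (_ + _); rewrite -addn1 PoszD.
  split; [apply: rt_trans IH1 _ | apply: rt_trans _ IH2]; apply: rt_step.
    by split; [exists (n + d%:Z) | exists (n + d%:Z + 1) | exact: step].
  by split; [exists (n + d%:Z + 1) | exists (n + d%:Z) | rewrite setIC; exact: step].
move=> _ _ [n _ <-] [n' _ <-].
have [h|h] := lerP n n'.
  have [W _] := walk (`|n' - n|%N) n; move: W.
  by rewrite gez0_abs ?subr_ge0 // subrKC.
have [_ W] := walk (`|n - n'|%N) n'; move: W.
by rewrite gez0_abs ?subr_ge0 ?ltW // subrKC.
Qed.

Lemma characteristic_cycleP (Theta : set M) : characteristic_cycle b Theta <->
  exists2 w : C, w != 0 & Theta = \bigcup_(A in lines w) A.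
Proof.
split.
  move=> [F [Ffam Fmax ->]]; have [[A FA] Fc _] := Ffam.
  have /Fc/characteristic_curveP[w [n [w0 AE]]] := FA; exists w => //.
  have sub : F `<=` lines w by apply: (curve_family_lines (n := n)) => //; rewrite -AE.
  by rewrite (Fmax _ (lines_curve_family w0) sub).
move=> [w w0 ->]; exists (lines w); split => //; first exact: lines_curve_family.
move=> G Gfam sub; apply/seteqP; split => //.
by apply: (curve_family_lines (n := 0)) => //; apply: sub; exists 0.
Qed.

(** Shifts of the chain by elements fixing w; as w is only multiplied by [qmul], they are the same
    for every nonzero w. *)
Definition stab (n : int) : Prop := exists j, qmul z1 (j, n) = 1.

Lemma stabP n : stab n <-> exists j N : int,
  (j + n)%:~R * z1 + (5 * j)%:~R * imagC R = N%:~R.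
Proof. by split=> -[j]; [move=> /qmul_eq1[N] | move=> [N hN]]; exists j; [exists N | apply/qmul_eq1; exists N]. Qed.

Lemma stab_lin n n' k : stab n -> stab n' -> stab (n - k * n').
Proof.
move=> /stabP[j [N h]] /stabP[j' [N' h']]; apply/stabP; exists (j - k * j'), (N - k * N').
have -> : j - k * j' + (n - k * n') = (j + n) - k * (j' + n') by ring.
have -> : 5 * (j - k * j') = 5 * j - k * (5 * j') by ring.
by rewrite !(intrB, intrM) -h -h' !(intrD, intrM); ring.
Qed.

Lemma stab0 : stab 0.
Proof. by exists 0; exact: qmul0. Qed.

(** A subgroup of Z is generated by its least positive element, or is trivial, in which case m =
    0. *)
Lemma stab_generator : exists m : nat, forall n, stab n <-> (m %| n)%Z.
Proof.
have [[n0 [n00 hn0]]|none] := pselect (exists n, n != 0 /\ stab n); last first.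
  exists 0%N => n; rewrite dvd0z; split; last by move=> /eqP ->; exact: stab0.
  by move=> hn; apply: contra_notT none => n0; exists n.
have ex : exists p : nat, (0 < p)%N && `[< stab p%:Z >].
  exists `|n0|%N; rewrite absz_gt0 n00 /=; apply/asboolP.
  have [h|h] := lerP 0 n0; first by rewrite gez0_abs.
  rewrite ltz0_abs //; have := stab_lin 1 stab0 hn0.
  by rewrite mul1r sub0r.
case: (ex_minnP ex) => m /andP[m0 /asboolP hm] mmin; exists m => n; split; last first.
  move=> /dvdzP[q ->]; have := stab_lin (- q) stab0 hm.
  by rewrite mulNr sub0r opprK.
move=> hn; have hr : stab (n %% m)%Z.
  have := stab_lin (n %/ m)%Z hn hm.
  by rewrite {1}(divz_eq n m) [_ + (n %% m)%Z]addrC addrK.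
have m0z : m%:Z != 0 by rewrite eqz_nat -lt0n.
have := modz_ge0 n m0z; have := ltz_mod n m0z.
case E : (n %% m)%Z hr => [r|r] // hr rm _.
apply/dvdz_mod0P; rewrite E; case: r hr rm {E} => [//|r] hr.
rewrite /= ltz_nat absz_nat => rm; have := mmin r.+1; rewrite [(m <= _)%N]leqNgt rm /=.
by move=> H; exfalso; have : false by apply: H; apply/asboolP.
Qed.

Lemma modz_dvdB (m : nat) (i c j : int) :
  (m %| (i %% m)%Z + c - (j %% m)%Z)%Z = (m %| i + c - j)%Z.
Proof.
have dvd_rem k : (m %| k - (k %% m)%Z)%Z.
  by rewrite {1}(divz_eq k m) addrK dvdz_mull.
have -> : i + c - j = (i %% m)%Z + c - (j %% m)%Z + ((i - (i %% m)%Z) - (j - (j %% m)%Z)).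
  by ring.
apply/esym/rpredDr; apply: rpredB; exact: dvd_rem.
Qed.

Lemma line_pt_stab (m : nat) (w : C) n s n' t : w != 0 ->
  (forall n, stab n <-> (m %| n)%Z) ->
  line_pt w n s = line_pt w n' t <->
  exists j k, [/\ qmul z1 (j, k) = 1, (m %| k)%Z &
    chain_pt n' t = chain_pt (n + k) (scaleP1 (rmul z1 (j, k))^-1 s)].
Proof.
move=> w0 hm; split.
  move=> /line_pt_eq[//|//|[j k] [qg hc]]; exists j, k.
  have q1 : qmul z1 (j, k) = 1 by apply: (mulIf w0); rewrite mul1r.
  by split => //; apply/hm; exists j.
move=> [j [k [qg _ hc]]]; apply/line_pt_eq => //.
by exists (j, k); rewrite qg mul1r.
Qed.

Lemma mul_rV1_entry (n : nat) (v : 'rV[C]_1) (A : 'rV[C]_n) j :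
  (v *m A) 0 j = v 0 0 * A 0 j.
Proof. by rewrite mxE big_ord1. Qed.

(** The curves are indexed through [(i %% m)%Z] so that congruent indices give the same
    parametrisation: lines identified by the group agree only up to a rescaling by [rmul]. For m = 0
    the remainder is i itself. *)
Lemma lines_chain_mod (m : nat) (w : C) : w != 0 -> (forall n, stab n <-> (m %| n)%Z) ->
  chain_mod m b (\bigcup_(A in lines w) A).
Proof.
move=> w0 hm; exists (fun i => line_pt w (i %% m)%Z).
have shift n n' s : (m %| n' - n)%Z -> exists2 c : C, c != 0 &
    line_pt w n s = line_pt w n' (scaleP1 c s).
  move=> /hm[j qj]; exists (rmul z1 (j, n' - n))^-1; first by rewrite invr_eq0 rmul_neq0.
  apply/(line_pt_stab n s n' _ w0 hm); exists j, (n' - n); split => //.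
    by apply/hm; exists j.
  by rewrite subrKC.
have rem_eq i j k : (m %| k)%Z -> (j %% m)%Z = (i %% m)%Z + k -> k = 0.
  move=> mk jE; have ij : (j %% m)%Z = (i %% m)%Z.
    apply/eqP; rewrite eqz_mod_dvd -[j]addr0 -modz_dvdB addr0 jE addrC addKr //.
  by move: jE; rewrite ij -{1}[(i %% m)%Z]addr0 => /addrI.
split.
- by move=> i; exact: line_fiber_map.
- move=> i j s t; split.
    move=> /(line_pt_stab _ _ _ _ w0 hm)[j0 [k [qk mk]]].
    move=> /chain_ptP[[jE tE]|[ik tE sE]|[ik tE sE]].
    + have k0 := rem_eq _ _ _ mk jE; constructor 1.
      have j00 : j0 = 0 by apply: (qmul_inj heps hz); rewrite -k0.
      split; first by rewrite jE k0 addr0.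
      by rewrite tE k0 j00 rmul0 invr1 scaleP11.
    + constructor 3; split => //; last first.
        case: s sE => //= x [/eqP]; rewrite mulf_eq0 invr_eq0 (negbTE (rmul_neq0 _ _)).
        by move=> /eqP ->.
      apply/eqP; rewrite eqz_mod_dvd.
      have -> : i - (j + 1) = i + -1 - j by ring.
      rewrite -modz_dvdB; have -> : (i %% m)%Z + -1 - (j %% m)%Z = - k.
        by rewrite -[(i %% m)%Z](addrK k) ik; ring.
      by rewrite rpredN.
    + constructor 2; split => //; last by case: s sE.
      apply/eqP; rewrite eqz_mod_dvd.
      have -> : j - (i + 1) = j + -1 - i by ring.
      rewrite -modz_dvdB; have -> : (j %% m)%Z + -1 - (i %% m)%Z = k by rewrite ik; ring.
      by [].
  case=> [[-> ->//]|[ji -> ->]|[ij -> ->]].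
    have [|c c0 E] := shift ((i %% m)%Z + 1) (j %% m)%Z (Some 0).
      rewrite -opprB rpredN modz_dvdB -eqz_mod_dvd. apply/eqP; exact: esym ji.
    by move: E; rewrite /= mulr0 => <-.
  have [|c c0 E] := shift ((j %% m)%Z + 1) (i %% m)%Z (Some 0).
    rewrite -opprB rpredN modz_dvdB -eqz_mod_dvd; apply/eqP; exact: esym ij.
  by move: E; rewrite /= mulr0 => <-.
(* When i + 1 wraps around, the next line must first be shifted into the chart n + 1, which rescales
   its coordinate by c. There the two branches are the y-axis and the x-axis. *)
- move=> i; pose n := (i %% m)%Z; pose n' := ((i + 1) %% m)%Z.
  have dv : (m %| n + 1 - n')%Z by rewrite modz_dvdB subrr dvdz0.
  have [j qj] : stab (n + 1 - n') by apply/hm.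
  pose c := (rmul z1 (j, n + 1 - n'))^-1.
  have c0 : c != 0 by rewrite invr_eq0 rmul_neq0.
  have uE : line_pt w n' \o @P1_zero R = fun s : C => line_pt w (n + 1) (Some (c * s)).
    apply/funext => s; apply/(line_pt_stab _ _ _ _ w0 hm); exists j, (n + 1 - n').
    by split => //; rewrite subrKC.
  exists (n + 1), (lin_lift z1 w 0 1), (lin_lift z1 w c 0); split.
  + exact: line_lifts_infty.
  + by rewrite uE; exact: line_lifts_zero.
  + by rewrite /lin_lift !mulr0.
  + rewrite !velocity_lin_lift.
    apply: inj_row_free => v; rewrite -[v]hsubmxK mul_row_col.
    move: (lsubmx v) (rsubmx v) => v1 v2 H.
    have E k : v1 0 0 * crd (vec4 0 0 0 1) k + v2 0 0 * crd (vec4 0 0 c 0) k = 0.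
      by have := congr1 (fun A : 'rV[C]_4 => A 0 (inord k)) H; rewrite mxE !mul_rV1_entry => ->; rewrite mxE.
    have [_ _ a2 a3] := crd_vec4 (0 : C) 0 0 1.
    have [_ _ b2 b3] := crd_vec4 (0 : C) 0 c 0.
    have := E 2; have := E 3%N; rewrite a2 a3 b2 b3 !(mulr0, mulr1, addr0, add0r).
    move=> v10 /eqP; rewrite mulf_eq0 (negbTE c0) orbF => /eqP v20.
    have -> : v1 = 0 by apply/rowP => k; rewrite ord1 v10 mxE.
    have -> : v2 = 0 by apply/rowP => k; rewrite ord1 v20 mxE.
    by rewrite row_mx0.
- apply/seteqP; split=> x.
    move=> [_ [n _ <-] [s _ <-]]; have [|c c0 E] := shift n (n %% m)%Z s.
      by rewrite -opprB rpredN {1}(divz_eq n m) addrK dvdz_mull.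
    by exists n; [by [] | rewrite E; exists (scaleP1 c s)].
  by move=> [i _ [s _ <-]]; exists (line w (i %% m)%Z); [exists (i %% m)%Z | exists s].
Qed.

Lemma chain_mod_stab (k : nat) (w : C) : w != 0 -> (0 < k)%N ->
  chain_mod k b (\bigcup_(A in lines w) A) -> exists2 n, n != 0 & stab n.
Proof.
move=> w0 k0 [u [ufib ueq _ TE]].
have hit (n : int) : exists i : 'I_k, exists s, line_pt w n (Some 1) = u i%:Z s.
  have : (\bigcup_(A in lines w) A) (line_pt w n (Some 1)).
    by exists (line w n); [exists n | exists (Some 1)].
  rewrite TE => -[i _ [s _ sE]].
  have kz : k%:Z != 0 by rewrite eqz_nat -lt0n.
  have := modz_ge0 i kz; have := ltz_pmod i (_ : 0 < k%:Z); rewrite ltz_nat k0 => /(_ isT).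
  case E : (i %% k)%Z => [r|//]; rewrite ltz_nat => rk _.
  exists (Ordinal rk), s; rewrite -sE; apply/ueq; constructor 1; split=> //=.
  by rewrite -E modz_mod.
have [f hf] := choice (fun n : 'I_k.+1 => hit n%:Z).
have : ~~ injectiveb f.
  by apply/negP => /injectiveP/leq_card; rewrite !card_ord ltnn.
move=> /injectivePn[n [n' nn' ff]].
have [w' [l [w0' ul]]] : exists w' l, w' != 0 /\ range (u (f n)%:Z) = line w' l.
  exact: (fiber_map_range heps hz (ufib _)).
have on_l (p : 'I_k.+1) : f p = f n -> exists j, w' = qmul z1 (j, l - p%:Z) * w.
  move=> fp; have [s sE] := hf p.
  have : line w' l (line_pt w p%:Z (Some 1)) by rewrite -ul -fp sE; exists s.
  move=> [t _ /esym/line_pt_eq[//|//|[j m] [qg /chain_ptP H]]].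
  exists j; suff -> : l - p%:Z = m by [].
  have r0 : (rmul z1 (j, m))^-1 * 1 != 0 by rewrite mulr1 invr_eq0 rmul_neq0.
  case: H => [[-> _]|[_ _ []]|[_ _ []]]; first by rewrite addrC addKr.
    by move=> /eqP; rewrite (negbTE r0).
  by [].
have [j hj] := on_l n erefl; have [j' hj'] := on_l n' (esym ff).
exists (n'%:Z - n%:Z).
  by rewrite subr_eq0 eqz_nat eq_sym; apply: contraNN nn' => /eqP/val_inj ->.
exists (j - j'); have := qmulD z1 (j, l - n%:Z) (- j', - (l - n'%:Z)).
have -> : (j - j', n'%:Z - n%:Z) = (j + - j', l - n%:Z + - (l - n'%:Z)).
  by congr (_, _); ring.
move=> /= ->; have := qmulN z1 (j', l - n'%:Z); rewrite /= => ->.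
have -> : qmul z1 (j, l - n%:Z) = qmul z1 (j', l - n'%:Z).
  by apply: (mulIf w0); rewrite -hj -hj'.
by rewrite divff // qmul_neq0.
Qed.

End Cycles.

(** * Periods and Gaussian rationals *)

Section Gaussian.
Variable R : realType.
Local Notation C := (Cx R).

Lemma ofR_ratr (q : rat) : ofR (ratr q) = ratr q :> C.
Proof. exact: (fmorph_rat (real_complex R)). Qed.

Lemma gaussian_parts (z : C) (p q : rat) :
  z = ratr p + ratr q * imagC R <-> rpart z = ratr p /\ ipart z = ratr q.
Proof.
rewrite -!ofR_ratr; split.
  move=> ->; rewrite rpartD ipartD rpart_ofRM ipart_ofRM.
  by rewrite /rpart /ipart /= mulr0 mulr1 addr0 add0r.
move=> [hp hq]; apply: C_eq.
  by rewrite hp rpartD rpart_ofRM /rpart /= mulr0 addr0.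
by rewrite hq ipartD ipart_ofRM /ipart /= mulr1 add0r.
Qed.

(** In one direction j + n is nonzero, since otherwise j = 0 and then n = 0, so both parts of z can
    be solved for. In the other, denominators are cleared. *)
Lemma gaussian_stab (z : C) : `|ipart z| < 1 ->
  gaussian_rational z <-> exists2 n, n != 0 & stab z n.
Proof.
move=> iz; have parts (j n N : int) : (j + n)%:~R * z + (5 * j)%:~R * imagC R = N%:~R <->
    (j + n)%:~R * rpart z = N%:~R /\ (j + n)%:~R * ipart z + (5 * j)%:~R = 0.
  rewrite -!ofR_int; split.
    move=> E; have := congr1 (@rpart R) E; have := congr1 (@ipart R) E.
    rewrite rpartD ipartD !rpart_ofRM !ipart_ofRM [ipart (imagC R)]/= [rpart (imagC R)]/=.
    by rewrite mulr0 mulr1 addr0.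
  move=> [E1 E2]; apply: C_eq; rewrite ?rpartD ?ipartD ?rpart_ofRM ?ipart_ofRM.
    by rewrite [rpart (imagC R)]/= mulr0 addr0 E1.
  by rewrite [ipart (imagC R)]/= mulr1 E2.
split; last first.
  move=> [n n0 /stabP[j [N /parts[E1 E2]]]].
  have jn0 : (j + n)%:~R != 0 :> R.
    rewrite intr_eq0; apply: contraNneq n0 => jn0; move: E2; rewrite jn0 mul0r add0r => /eqP.
    by rewrite intr_eq0 mulf_eq0 /= => /eqP j0; move: jn0; rewrite j0 add0r => ->.
  exists (N%:~R / (j + n)%:~R), (- (5 * j)%:~R / (j + n)%:~R); apply/gaussian_parts.
  rewrite !fmorph_div /= rmorphN /= !ratr_int; split.
    by rewrite -E1 mulrC mulKf.
  by apply: (mulfI jn0); rewrite mulrCA divff // mulr1; apply/eqP; rewrite -addr_eq0 E2.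
move=> [p [q /gaussian_parts[hp hq]]].
pose dp := denq p; pose dq := denq q.
have dp0 : dp%:~R != 0 :> R by rewrite intr_eq0 denq_neq0.
have dq0 : dq%:~R != 0 :> R by rewrite intr_eq0 denq_neq0.
have pE : rpart z = (numq p)%:~R / dp%:~R by rewrite hp.
have qE : ipart z = (numq q)%:~R / dq%:~R by rewrite hq.
(* Chosen so that j + n = 5 dp dq clears both denominators; n = dp dq (5 + Im z) is nonzero because
   |Im z| < 1. *)
exists (5 * dp * dq + dp * numq q); last first.
  apply/stabP; exists (- (dp * numq q)), (5 * numq p * dq); apply/parts.
  have -> : - (dp * numq q) + (5 * dp * dq + dp * numq q) = 5 * dp * dq by ring.
  by rewrite pE qE mulrN intrN !intrM; split; field.
have -> : 5 * dp * dq + dp * numq q = dp * (5 * dq + numq q) by ring.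
rewrite mulf_neq0 ?denq_neq0 // -(intr_eq0 R) intrD intrM.
have -> : (numq q)%:~R = ipart z * dq%:~R by rewrite qE divfK.
rewrite -mulrDl mulf_neq0 //; move: iz; rewrite ltr_norml => /andP[h1 h2].
by rewrite gt_eqF //; have -> : 5%:~R = 5 :> R by []; lra.
Qed.

Lemma stab_inv_nat (k : nat) n : (0 < k)%N -> stab (k%:R^-1 : C) n <-> (k %| n)%Z.
Proof.
move=> k0; have kn0 : k%:R != 0 :> C by rewrite pnatr_eq0 -lt0n.
rewrite stabP; split.
  move=> [j [N E]]; have := congr1 (@ipart R) E.
  have kE : k%:R^-1 = ofR k%:R^-1 :> C by rewrite ofRV ofR_nat.
  rewrite kE -!ofR_int ipartD !ipart_ofRM [ipart (imagC R)]/= [ipart (ofR _)]/=.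
  rewrite [ipart (ofR _)]/= mulr0 add0r mulr1 => /eqP.
  rewrite intr_eq0 mulf_eq0 /= => /eqP j0; move: E; rewrite j0 mulr0 mul0r addr0 add0r.
  move=> E; apply/dvdzP; exists N; apply/eqP; rewrite -(eqr_int C) intrM -E.
  by rewrite -[(k%:Z)%:~R]/(k%:R) divfK.
move=> /dvdzP[N ->]; exists 0, N; rewrite mulr0 mul0r addr0 add0r intrM.
by rewrite -[(k%:Z)%:~R]/(k%:R) mulfK.
Qed.

Lemma gaussian_near (z : C) (d : R) : 0 < d ->
  exists2 z' : C, cmod (z' - z) < d & gaussian_rational z'.
Proof.
move=> d0; have near_rat (x : R) : exists q : rat, `|ratr q - x| < d / 2.
  have [|q] := @rat_in_itvoo R (x - d / 2) (x + d / 2).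
    by rewrite ltrD2l gtrN // divr_gt0.
  by rewrite in_itv /= -ltr_distl => h; exists q.
have [p hp] := near_rat (rpart z); have [q hq] := near_rat (ipart z).
exists (ratr p + ratr q * imagC R); last by exists p, q.
have /gaussian_parts[rE iE] : ratr p + ratr q * imagC R = ratr p + ratr q * imagC R by [].
apply: le_lt_trans (cmod_le _) _; rewrite rpartD ipartD rpartN ipartN rE iE.
by rewrite [d]splitr; exact: ltrD.
Qed.

(** A Gaussian rational is moved by a small nonzero rational multiple of pi, which makes its real
    part irrational. *)
Lemma not_gaussian_near (z : C) (d : R) : 0 < d ->
  exists2 z' : C, cmod (z' - z) < d & ~ gaussian_rational z'.
Proof.
move=> d0; have [[p [q /gaussian_parts[rE iE]]]|] := pselect (gaussian_rational z); last first.
  by exists z; rewrite ?subrr ?cmod0.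
have pi0 := trigo.pi_gt0 R.
have [|t] := @rat_in_itvoo R 0 (d / trigo.pi); first by rewrite divr_gt0.
rewrite in_itv /= (ltr_pdivlMr _ _ pi0) => /andP[t0 td].
have tn0 : ratr t != 0 :> R by rewrite (gt_eqF t0).
exists (z + ofR (ratr t * trigo.pi)).
  by rewrite addrC addKr cmod_ofR gtr0_norm // mulr_gt0.
move=> [p' [q' /gaussian_parts[]]]; rewrite rpartD rE => E _.
apply: (@pi_irrationnal R); exists ((p' - p) / t) => //.
rewrite fmorph_div /= rmorphB /= -E [rpart (ofR _)]/=.
by rewrite [ratr p + _]addrC addrK mulrC mulKf.
Qed.

End Gaussian.

(** * From the stabiliser to the types of the fibres *)

Section FibreTypes.
Variables (R : realType) (eps : R).
Hypothesis heps : eps <= 1.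
Local Notation C := (Cx R).
Local Notation Psi := (Psi0 R).

Lemma has_cycle_typeP (z1 : C) (hz : in_polydisk eps (z1, 0))
    (P : C * C -> set (M Psi eps) -> Prop) :
  has_cycle_type (z1, 0) P <->
  forall w : C, w != 0 -> P (z1, 0) (\bigcup_(A in lines hz w) A).
Proof.
split.
  by move=> [_ H] w w0; apply: H; apply/(characteristic_cycleP heps hz); exists w.
move=> H; split; last by move=> Theta /(characteristic_cycleP heps hz)[w w0 ->]; exact: H.
exists (\bigcup_(A in lines hz 1) A); apply/(characteristic_cycleP heps hz).
by exists 1; rewrite ?oner_neq0.
Qed.

Lemma cycle_I_stab (z1 : C) (k : nat) : in_polydisk eps (z1, 0) -> (0 < k)%N ->
  (forall n, stab z1 n <-> (k %| n)%Z) -> cycle_I Psi eps k (z1, 0).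
Proof.
move=> hz k0 hk; apply/(has_cycle_typeP hz) => w w0; split => //.
exact: lines_chain_mod.
Qed.

Lemma cycle_I_infty_stab (z1 : C) : in_polydisk eps (z1, 0) ->
  ~ (exists2 n, n != 0 & stab z1 n) -> cycle_I_infty Psi eps (z1, 0).
Proof.
move=> hz hn; apply/(has_cycle_typeP hz) => w w0.
apply: lines_chain_mod => // n; rewrite dvd0z; split; last by move=> /eqP ->; exact: stab0.
by move=> sn; apply: contra_notT hn => n0; exists n.
Qed.

Lemma cycle_I_iff_stab (z1 : C) : in_polydisk eps (z1, 0) ->
  (exists k, cycle_I Psi eps k (z1, 0)) <-> exists2 n, n != 0 & stab z1 n.
Proof.
move=> hz; split.
  move=> [k /(has_cycle_typeP hz)/(_ 1 (oner_neq0 _))[k0]].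
  exact: chain_mod_stab (oner_neq0 _) k0.
move=> [n n0 sn]; have [m hm] := stab_generator z1.
exists m; apply: cycle_I_stab => //; rewrite lt0n; apply: contraNneq n0 => m0.
by move/hm: sn; rewrite m0 dvd0z.
Qed.

Lemma discriminantE : discriminant Psi eps = [set b | polydisk eps b /\ b.2 = 0].
Proof.
apply/seteqP; split.
  move=> _ [m mcrit <-]; have [k [v [hv _]]] := mcrit.
  have [x0 y0] := (critical_coords hv).1 mcrit.
  have [p pE ->] := hv; rewrite fibr_pi; split; last by rewrite pE /base /= z2E_pt x0 mul0r.
  by have /andP[] := valP p.
move=> [z1 z2] [/= hz z20]; rewrite z20 in hz *.
exists (line_pt hz 1 0 (Some 0)); last by rewrite fibr_Mpt ?oner_neq0 ?z2E_chain.
by apply/line_pt_critical; [exact: oner_neq0 | left].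
Qed.

Lemma closure_discriminant (P : C -> Prop) :
  (forall (z : C) (d : R), 0 < d -> exists2 z' : C, cmod (z' - z) < d & P z') ->
  discriminant Psi eps `<=`
    closure [set b | discriminant Psi eps b /\ (in_polydisk eps (b.1, 0) -> P b.1)].
Proof.
move=> dense; rewrite discriminantE => -[z z2] [/= hz z20]; rewrite z20 in hz *.
move=> U [[U1 U2] [/= /nearCP[d d0 hd] hU2] hU].
have {}hU2 : U2 0 := nearC_self (s := 0 : C) hU2.
have zeps : cmod z < eps.
  by move: hz; rewrite /polydisk /in_polydisk /= normE ltr_ofR => /andP[].
(* The first radius keeps z' in the given neighbourhood, the second keeps it in the disc. *)
have [|z' hz' Pz'] := dense z (Num.min d (eps - cmod z)).
  by rewrite lt_min d0 subr_gt0.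
move: hz'; rewrite lt_min => /andP[z'd z'eps].
exists (z', 0); split; last by apply: hU; split => //=; exact: hd.
have e0 : 0 < eps := le_lt_trans (cmod_ge0 z) zeps.
have z'lt : cmod z' < eps.
  rewrite -[z'](subrK z); apply: le_lt_trans (cmodD _ _) _.
  by rewrite -ltrBrDr.
split=> //; split=> //; apply/andP; split; first by rewrite /= normE ltr_ofR.
by rewrite /= normE cmod0 ltr_ofR.
Qed.

End FibreTypes.

Theorem proposition5p3 (R : realType) :
  exists2 eps0 : R, 0 < eps0 &
  forall eps : R, 0 < eps -> eps <= eps0 ->
  let B := polydisk eps in
  let Delta := discriminant (Psi0 R) eps in
  let I_ := cycle_I (Psi0 R) eps in
  let I_infty := cycle_I_infty (Psi0 R) eps in
  [/\ Delta = [set b | B b /\ b.2 = 0],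
      forall z1 : Cx R, B (z1, 0) ->
        (exists k : nat, I_ k (z1, 0)) <-> gaussian_rational z1,
      Delta `<=` closure [set b | Delta b /\ exists k : nat, I_ k b] /\
      Delta `<=` closure [set b | Delta b /\ I_infty b],
      forall k : nat, (0 < k)%N -> B (k%:R^-1, 0) -> I_ k (k%:R^-1, 0) &
      exists K : nat, forall k : nat, (K <= k)%N ->
        exists b : Cx R * Cx R, Delta b /\ I_ k b].
Proof.
(* The radius 1 ensures |Im z1| < 1, enough for Im z1 + 5 to be nonzero. *)
exists 1 => // eps eps0 eps1 B Delta I_ I_infty.
have iff_gauss (z1 : Cx R) : B (z1, 0) ->
    (exists k : nat, I_ k (z1, 0)) <-> gaussian_rational z1.
  move=> hz; rewrite gaussian_stab; last exact: ipart_z1 eps1 hz.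
  exact: cycle_I_iff_stab.
have inv_type (k : nat) : (0 < k)%N -> B (k%:R^-1, 0) -> I_ k (k%:R^-1, 0).
  by move=> k0 hB; apply: cycle_I_stab => // n; exact: stab_inv_nat.
have DE : Delta = [set b | B b /\ b.2 = 0] := discriminantE eps.
split => //.
- split.
    apply: subset_trans (closure_discriminant (@gaussian_near R)) _.
    apply: closureS => -[z z2] [Db /= hP]; split => //.
    have [Bz /= z20] : B (z, z2) /\ (z, z2).2 = 0 by move: Db; rewrite -/Delta DE.
    by rewrite z20 in Bz *; apply/iff_gauss => //; exact: hP.
  apply: subset_trans (closure_discriminant (@not_gaussian_near R)) _.
  apply: closureS => -[z z2] [Db /= hP]; split => //.
  have [Bz /= z20] : B (z, z2) /\ (z, z2).2 = 0 by move: Db; rewrite -/Delta DE.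
  rewrite z20 in Bz *; apply: cycle_I_infty_stab => // hs; apply: hP => //.
  by apply/gaussian_stab => //; exact: ipart_z1 eps1 Bz.
(* Above this bound 1/k < eps; the successor also ensures k > 0. *)
- exists (Num.bound eps^-1).+1 => k hk.
  have k0 : (0 < k)%N by exact: leq_trans hk.
  have kR : 0 < k%:R :> R by rewrite ltr0n.
  have Bk : B (k%:R^-1, 0).
    rewrite /B /polydisk /in_polydisk /= normr0 -ofR_nat -ofRV normE cmod_ofR !ltr_ofR.
    rewrite eps0 andbT ger0_norm ?invr_ge0 ?ler0n //.
    rewrite -[eps]invrK ltf_pV2 ?posrE ?invr_gt0 //.
    apply: lt_trans (archi_boundP _) _; first by rewrite invr_ge0 ltW.
    by rewrite ltr_nat.
  by exists (k%:R^-1, 0); split; [rewrite DE | exact: inv_type].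
Qed.
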